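(* Let $E$ be a symmetric space on $I=[0,\alpha)$, $\alpha\in\{1,\infty\}$, with the Fatou property and with fundamental function $\phi$ such that, in the case $I=[0,\infty)$, $\phi(\infty)=\infty$. The following conditions are equivalent. (i) $E$ is decreasing uniformly $K$-monotone. (ii) $E$ is $K$-order continuous and upper locally uniformly $K$-monotone.
   Context: Let $I=[0,\alpha)$, $\alpha=1$ or $\alpha=\infty$, with Lebesgue measure $\mu$, and let $L^0$ be the set of (classes of a.e. equal) extended real valued measurable functions on $I$. A Banach function space $(E,\|\cdot\|_E)$ is a Banach lattice that is a sublattice of $L^0$ such that (1) if $x\in L^0$, $y\in E$, $|x|\le|y|$ a.e., then $x\in E$ and $\|x\|_E\le\|y\|_E$; (2) there is a strictly positive $x\in E$. $E^+=\{x\in E:x\ge0\}$. Fatou property: if $(x_n)\subset E^+$, $\sup_n\|x_n\|_E<\infty$ and $x_n\uparrow x\in L^0$, then $x\in E$ and $\|x_n\|_E\uparrow\|x\|_E$. For $x\in L^0$: $d_x(\lambda)=\mu\{s\in I:|x(s)|>\lambda\}$, $x^*(t)=\inf\{\lambda>0:d_x(\lambda)\le t\}$, $x^{**}(t)=\frac1t\int_0^t x^*(s)\,ds$. $E$ is symmetric if $x\in L^0$, $y\in E$, $d_x=d_y$ imply $x\in E$ and $\|x\|_E=\|y\|_E$. For $x,y\in L^1+L^\infty$, $x\prec y$ means $x^{**}(t)\le y^{**}(t)$ for all $t>0$. The fundamental function is $\phi(t)=\|\chi_{(0,t)}\|_E$, and $\phi(\infty)=\lim_{t\to\infty}\phi(t)$.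 $E$ is decreasing uniformly $K$-monotone if for any $(x_n),(y_n)\subset E$ with $x_{n+1}\prec x_n\prec y_n$ for all $n\in\mathbb N$ and $\lim_n\|x_n\|_E=\lim_n\|y_n\|_E<\infty$ one has $\|x_n^*-y_n^*\|_E\to0$. $E$ is $K$-order continuous if for every $x\in E$ and every $(x_n)\subset E$ with $x_n\prec x$ for all $n$ and $x_n^*\to0$ a.e. one has $\|x_n\|_E\to0$. $E$ is upper locally uniformly $K$-monotone if for every $x\in E$ and every $(x_n)\subset E$ with $x\prec x_n$ for all $n$ and $\|x_n\|_E\to\|x\|_E$ one has $\|x^*-x_n^*\|_E\to0$. *)

(* Defs.v *)
From HB Require Import structures.
From mathcomp Require Import all_boot all_order all_algebra.
From mathcomp Require Import all_classical all_reals all_analysis.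
From mathcomp Require Import measurable_realfun.
Set Implicit Arguments.
Unset Strict Implicit.
Unset Printing Implicit Defensive.
Import Order.TTheory GRing.Theory Num.Theory.
Import numFieldNormedType.Exports.
Local Open Scope classical_set_scope.
Local Open Scope ring_scope.

Definition dom (R : realType) (alpha : \bar R) : set R :=
  [set t | 0 <= t /\ (t%:E < alpha)%E].

(* A class in L^0 is represented by any Borel function on [0, alpha) in it
   (every Lebesgue measurable function has a Borel representative); values
   outside [0, alpha) are junk and never matter. *)
Definition L0 (R : realType) (alpha : \bar R) : set (R -> \bar R) :=
  [set x : R -> \bar R | measurable_fun (dom alpha) x].

Definition ae_dom (R : realType) (alpha : \bar R) (P : R -> Prop) : Prop :=
  {ae @lebesgue_measure R, forall t, dom alpha t -> P t}.

(* [bfs_mem] is a set of representatives, saturated for a.e. equality by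
   [bfs_solid]; the value of [bfs_norm] outside [bfs_mem] is irrelevant.
   Since E is a vector space its elements are a.e. finite, so that the
   pointwise operations below are well defined up to a.e. equality. *)
Record banachFunctionSpace (R : realType) (alpha : \bar R) := BFS {
  bfs_mem : set (R -> \bar R) ;
  bfs_norm : (R -> \bar R) -> R ;
  bfs_L0 : bfs_mem `<=` L0 alpha ;
  bfs_fin : forall x, bfs_mem x -> ae_dom alpha (fun t => x t \is a fin_num) ;
  bfs_add : forall x y, bfs_mem x -> bfs_mem y ->
    bfs_mem (fun t => x t + y t)%E ;
  bfs_scale : forall (r : R) x, bfs_mem x -> bfs_mem (fun t => r%:E * x t)%E ;
  bfs_max : forall x y, bfs_mem x -> bfs_mem y ->
    bfs_mem (fun t => maxe (x t) (y t)) ;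
  bfs_min : forall x y, bfs_mem x -> bfs_mem y ->
    bfs_mem (fun t => mine (x t) (y t)) ;
  bfs_norm_add : forall x y, bfs_mem x -> bfs_mem y ->
    bfs_norm (fun t => x t + y t)%E <= bfs_norm x + bfs_norm y ;
  bfs_norm_scale : forall (r : R) x, bfs_mem x ->
    bfs_norm (fun t => r%:E * x t)%E = `|r| * bfs_norm x ;
  bfs_norm_eq0 : forall x, bfs_mem x -> bfs_norm x = 0 ->
    ae_dom alpha (fun t => x t = 0%E) ;
  bfs_complete : forall u : nat -> R -> \bar R,
    (forall n, bfs_mem (u n)) ->
    (forall e : R, 0 < e -> exists k : nat, forall m n : nat,
       (k <= m)%N -> (k <= n)%N ->
       bfs_norm (fun t => u m t - u n t)%E < e) ->
    exists2 x, bfs_mem x &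
      bfs_norm (fun t => u n t - x t)%E @[n --> \oo] --> (0 : R) ;
  bfs_solid : forall x y, L0 alpha x -> bfs_mem y ->
    ae_dom alpha (fun t => `|x t| <= `|y t|)%E ->
    bfs_mem x /\ bfs_norm x <= bfs_norm y ;
  bfs_weak_unit : exists2 x, bfs_mem x & ae_dom alpha (fun t => 0 < x t)%E
}.

Definition distr_fun (R : realType) (alpha : \bar R) (x : R -> \bar R)
    (l : R) : \bar R :=
  @lebesgue_measure R (dom alpha `&` [set s | (l%:E < `|x s|)%E]).

Definition rearr (R : realType) (alpha : \bar R) (x : R -> \bar R) (t : R) :
    \bar R :=
  ereal_inf [set l%:E | l in
    [set l : R | 0 < l /\ (distr_fun alpha x l <= t%:E)%E]].

Definition max_rearr (R : realType) (alpha : \bar R) (x : R -> \bar R)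
    (t : R) : \bar R :=
  ((t^-1)%R%:E * \int[@lebesgue_measure R]_(s in `[0%R, t]) rearr alpha x s)%E.

(* Only applied to elements of symmetric spaces, which lie in L^1 + L^oo. *)
Definition submaj (R : realType) (alpha : \bar R) (x y : R -> \bar R) : Prop :=
  forall t : R, 0 < t -> (max_rearr alpha x t <= max_rearr alpha y t)%E.

Definition rearr_dist (R : realType) (alpha : \bar R)
    (E : banachFunctionSpace alpha) (x y : R -> \bar R) : R :=
  bfs_norm E (fun t => rearr alpha x t - rearr alpha y t)%E.

Definition symmetric_space (R : realType) (alpha : \bar R)
    (E : banachFunctionSpace alpha) : Prop :=
  forall x y, L0 alpha x -> bfs_mem E y ->
    (forall l : R, 0 <= l -> distr_fun alpha x l = distr_fun alpha y l) ->
    bfs_mem E x /\ bfs_norm E x = bfs_norm E y.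

Definition fatou_property (R : realType) (alpha : \bar R)
    (E : banachFunctionSpace alpha) : Prop :=
  forall (u : nat -> R -> \bar R) (x : R -> \bar R),
    (forall n, bfs_mem E (u n) /\ ae_dom alpha (fun t => 0 <= u n t)%E) ->
    (exists M : R, forall n, bfs_norm E (u n) <= M) ->
    L0 alpha x ->
    (forall n, ae_dom alpha (fun t => u n t <= u n.+1 t)%E) ->
    ae_dom alpha (fun t => u n t @[n --> \oo] --> x t) ->
    [/\ bfs_mem E x,
        (forall n, bfs_norm E (u n) <= bfs_norm E (u n.+1)) &
        bfs_norm E (u n) @[n --> \oo] --> bfs_norm E x].

Definition fundamental_fun (R : realType) (alpha : \bar R)
    (E : banachFunctionSpace alpha) (t : R) : R :=
  bfs_norm E (fun s => (\1_(`]0, t[ : set R) s)%:E).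

Definition decreasing_uniformly_K_monotone (R : realType) (alpha : \bar R)
    (E : banachFunctionSpace alpha) : Prop :=
  forall (x y : nat -> R -> \bar R) (l : R),
    (forall n, bfs_mem E (x n)) -> (forall n, bfs_mem E (y n)) ->
    (forall n, submaj alpha (x n.+1) (x n) /\ submaj alpha (x n) (y n)) ->
    bfs_norm E (x n) @[n --> \oo] --> l ->
    bfs_norm E (y n) @[n --> \oo] --> l ->
    rearr_dist E (x n) (y n) @[n --> \oo] --> (0 : R).

Definition K_order_continuous (R : realType) (alpha : \bar R)
    (E : banachFunctionSpace alpha) : Prop :=
  forall (x : R -> \bar R) (u : nat -> R -> \bar R),
    bfs_mem E x -> (forall n, bfs_mem E (u n)) ->
    (forall n, submaj alpha (u n) x) ->
    ae_dom alpha (fun t => rearr alpha (u n) t @[n --> \oo] --> 0%E) ->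
    bfs_norm E (u n) @[n --> \oo] --> (0 : R).

Definition upper_locally_uniformly_K_monotone (R : realType) (alpha : \bar R)
    (E : banachFunctionSpace alpha) : Prop :=
  forall (x : R -> \bar R) (u : nat -> R -> \bar R),
    bfs_mem E x -> (forall n, bfs_mem E (u n)) ->
    (forall n, submaj alpha x (u n)) ->
    bfs_norm E (u n) @[n --> \oo] --> bfs_norm E x ->
    rearr_dist E x (u n) @[n --> \oo] --> (0 : R).

(* Main.v *)
Require Import Defs.
From HB Require Import structures.
From mathcomp Require Import all_boot all_order all_algebra.
From mathcomp Require Import all_classical all_reals all_analysis.
From mathcomp Require Import measurable_realfun perm ring lra.
Set Implicit Arguments.
Unset Strict Implicit.
Unset Printing Implicit Defensive.
Import Order.TTheory GRing.Theory Num.Theory.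
Import numFieldNormedType.Exports.
Local Open Scope classical_set_scope.
Local Open Scope ring_scope.

(* Write x* for the rearrangement and X(t) for its integral over [0, t].

   K-monotonicity (x < y in the sense of submajorization and y in E imply x in E
   and |x| <= |y|) comes from step functions: on a grid of equal cells a weakly
   majorized decreasing vector is reached from the majorizing one by finitely
   many T-transforms, i.e. convex combinations with the vector with two entries
   exchanged, and these do not increase a symmetric norm. The Fatou property
   passes this to the limit. The same argument shows that X(t) is finite.

   (i) => (ii). Upper local uniform K-monotonicity is the case of a constant
   sequence. Let u_k < x with u_k* -> 0. Replace X by its chord over
   [1/(n+2), n+2] and let z_n be the derivative. Since chords of a concave
   function decrease when the interval grows, z_(n+1) < z_n < x, and u_k < z_n
   for k large. As z_n -> 0 pointwise, if |z_n| did not tend to 0, then by Fatou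
   each z_n would stay away from z_m for some arbitrarily large m = m(n), which
   contradicts (i) for the pair of sequences z_(m(n)) < z_n.

   (ii) => (i). Let x_(n+1) < x_n < y_n. The function p = liminf x_n* satisfies
   p < x_n by Fatou's lemma. The primitives X_n decrease, so their difference
   quotients converge, which forces x_n* -> p off the jumps of p. Because
   phi(oo) = oo, the functions (x_n* - p)^+ exceed a given level only inside a
   fixed bounded interval, hence they tend to 0 in measure, and in norm by K-order
   continuity. So |x_n| -> |p|, and upper local uniform K-monotonicity at p
   applies to both (x_n) and (y_n). *)

(** * Decreasing rearrangements *)

Lemma lte_fin_between (R : realType) (a b : \bar R) : (a < b)%E ->
  exists r : R, (a < r%:E)%E /\ (r%:E < b)%E.
Proof.
case: a b => [a| |] [b| |] //= ab.
- exists ((a + b) / 2); rewrite !lte_fin in ab *; lra.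
- by exists (a + 1); rewrite lte_fin ltrDl ltr01 ltry.
- by exists (b - 1); rewrite ltNyr lte_fin ltrBlDl ltrDr ltr01.
- by exists 0; rewrite ltNyr ltry.
Qed.

Lemma ge0_le_fin_lt (R : realType) (a b : \bar R) : (0 <= a)%E -> (a < b)%E ->
  exists r : R, [/\ 0 <= r, (a <= r%:E)%E & (r%:E < b)%E].
Proof.
move=> a0 ab; have afin : a \is a fin_num.
  by rewrite ge0_fin_numE// (lt_le_trans ab)// leey.
by exists (fine a); rewrite fine_ge0// fineK.
Qed.

Lemma lebesgue_measure_itv_le (R : realType) (a b : R) (c d : bool) : a <= b ->
  @lebesgue_measure R [set` Interval (BSide c a) (BSide d b)] = (b - a)%:E.
Proof.
move=> ab; rewrite lebesgue_measure_itv/= lte_fin.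
by case: ltP => // ba; rewrite (_ : a = b) ?subrr//; apply/eqP; rewrite eq_le ab.
Qed.

Lemma lebesgue_measure_dom (R : realType) (d : \bar R) : (0 <= d)%E ->
  @lebesgue_measure R (dom d) = d.
Proof.
case: d => [a| |] // a0.
  rewrite (_ : dom a%:E = `[0, a[%classic) ?lebesgue_measure_itv_le ?subr0//.
  by apply/seteqP; split => t; rewrite /dom/= in_itv/= lte_fin; [move=> [-> ->]|move=> /andP].
rewrite (_ : dom +oo%E = `[0, +oo[%classic) ?lebesgue_measure_itv/= ?ltry//.
by apply/seteqP; split => t; rewrite /dom/= in_itv/= andbT ltry; [move=> [->]|].
Qed.

Section rearrangement.
Context (R : realType) (alpha : \bar R).
Implicit Types (x y : R -> \bar R) (l s t : R).
Local Notation mu := (@lebesgue_measure R).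

Lemma measurable_dom : measurable (dom alpha).
Proof.
apply: is_interval_measurable => s t/= [s0 sa] [t0 ta] r /andP[sr rt].
by split; [exact: le_trans sr|rewrite (le_lt_trans _ ta)// lee_fin].
Qed.

Lemma dom_le s t : 0 <= s -> s <= t -> dom alpha t -> dom alpha s.
Proof.
by move=> s0 st [_ ta]; split => //; apply: le_lt_trans ta; rewrite lee_fin.
Qed.

Lemma measurable_distr_set x l : L0 alpha x ->
  measurable (dom alpha `&` [set s | (l%:E < `|x s|)%E]).
Proof.
move=> mx; apply: emeasurable_fun_o_infty; first exact: measurable_dom.
by apply: measurableT_comp mx; exact: abse_measurable.
Qed.

Lemma distr_fun_ge0 x l : (0 <= distr_fun alpha x l)%E.
Proof. exact: measure_ge0. Qed.

Lemma le_distr_fun x y l : L0 alpha x -> L0 alpha y ->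
  ae_dom alpha (fun t => `|x t| <= `|y t|)%E ->
  (distr_fun alpha x l <= distr_fun alpha y l)%E.
Proof.
move=> mx my [N [mN N0 xyN]]; rewrite /distr_fun.
set A := dom alpha `&` _; set B := dom alpha `&` _.
have mA : measurable A by exact: measurable_distr_set.
have mB : measurable B by exact: measurable_distr_set.
have mBN : measurable (B `|` N) by exact: measurableU.
have AB : A `<=` B `|` N.
  move=> t [dt lt]; case: (pselect (N t)) => [|Nt]; first by right.
  left; split => //=; apply: (lt_le_trans lt).
  by apply: contrapT => xyt; apply: Nt; apply: xyN => /= /(_ dt).
apply: (@le_trans _ _ (mu (B `|` N))).
  by apply: le_measure => //; rewrite inE.
apply: (@le_trans _ _ (mu B + mu N)%E); first exact: measureU2.
by rewrite [mu N]N0 adde0.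
Qed.

(** The sets where [|x|] exceeds [l + 1/(n+1)] increase to the set where it exceeds [l], so
    continuity of the measure from below makes the distribution function d_x right continuous. *)
Lemma distr_fun_rcont x l t : L0 alpha x -> (t%:E < distr_fun alpha x l)%E ->
  exists2 e : R, 0 < e & (t%:E < distr_fun alpha x (l + e))%E.
Proof.
move=> mx lt; apply: contrapT => H.
have {}H e : 0 < e -> (distr_fun alpha x (l + e) <= t%:E)%E.
  by move=> e0; rewrite leNgt; apply/negP => te; apply: H; exists e.
pose F n := dom alpha `&` [set s | ((l + n.+1%:R^-1)%:E < `|x s|)%E].
have mF n : measurable (F n) by exact: measurable_distr_set.
have UF : \bigcup_n F n = dom alpha `&` [set s | (l%:E < `|x s|)%E].
  apply/seteqP; split=> [s [n _ [ds ls]]|s [ds]/= ls].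
    by split => //=; apply: le_lt_trans ls; rewrite lee_fin lerDl.
  have [r [lr rx]] := lte_fin_between ls.
  have [n nr] := ltr_add_invr lr; exists n => //; split => //=.
  by apply: lt_trans rx; rewrite lte_fin.
have ndF : {homo F : n m / (n <= m)%N >-> (n <= m)%O}.
  move=> n m nm; apply/subsetPset => s [ds ls]; split => //=.
  by apply: le_lt_trans ls; rewrite lee_fin lerD2l lef_pV2 ?posrE// ler_nat.
have cF : mu \o F @ \oo --> distr_fun alpha x l.
  rewrite /distr_fun -UF; apply: nondecreasing_cvg_mu => //.
  by apply: bigcup_measurable => n _; exact: mF.
have := lt; apply/negP; rewrite -leNgt -(cvg_lim _ cF)//.
apply: lime_le; first by apply/cvg_ex; eexists; exact: cF.
by apply: nearW => n; apply: H; rewrite invr_gt0.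
Qed.

(** A Galois connection between x* and d_x, resting on the right continuity of d_x. It replaces the
    infimum by a comparison of [t] with d_x(l). *)
Lemma gt_rearr x l t : L0 alpha x -> 0 <= l ->
  (l%:E < rearr alpha x t)%E = (t%:E < distr_fun alpha x l)%E.
Proof.
move=> mx l0; apply/idP/idP => [lt|].
  rewrite ltNge; apply/negP => dt; have := lt; apply/negP; rewrite -leNgt.
  (* The infimum runs over positive levels only and [l] may be 0, so the levels [l + e] are used. *)
  apply/lee_addgt0Pr => e e0; rewrite -EFinD; apply: ereal_inf_lbound.
  exists (l + e) => //; split; first exact: ltr_wpDl.
  apply: le_trans dt; apply: le_measure; rewrite ?inE; try exact: measurable_distr_set.
  by move=> s [ds/= ls]; split => //=; apply: le_lt_trans ls; rewrite lee_fin lerDl ltW.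
move=> /(distr_fun_rcont mx)[e e0 te].
apply: (@lt_le_trans _ _ (l + e)%:E); first by rewrite lte_fin ltrDl.
apply: le_ereal_inf_tmp => _ [k [k0 dk] <-]; rewrite lee_fin leNgt; apply/negP => ke.
have := le_lt_trans dk te; rewrite ltNge => /negP; apply.
apply: le_measure; rewrite ?inE; try exact: measurable_distr_set.
by move=> s [ds/= ls]; split => //=; apply: lt_trans ls; rewrite lte_fin.
Qed.

Lemma rearr_ge0 x t : (0 <= rearr alpha x t)%E.
Proof. by apply: le_ereal_inf_tmp => _ [k [k0 _] <-]; rewrite lee_fin ltW. Qed.

Lemma rearr_antitone x s t : s <= t -> (rearr alpha x t <= rearr alpha x s)%E.
Proof.
move=> st; apply: ereal_inf_le_tmp => _ [k [k0 dk] <-]; exists k => //.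
by split => //; apply: (le_trans dk); rewrite lee_fin.
Qed.

Lemma eq_rearr x y : (forall l, 0 <= l -> distr_fun alpha x l = distr_fun alpha y l) ->
  rearr alpha x = rearr alpha y.
Proof.
move=> xy; apply/funext => t; rewrite /rearr; congr ereal_inf; apply/seteqP.
by split=> _ [k [k0 dk] <-]; exists k => //; split=> //; rewrite ?xy ?(ltW k0)// -xy// ltW.
Qed.

Lemma le_rearr x y t : L0 alpha x -> L0 alpha y ->
  ae_dom alpha (fun t => `|x t| <= `|y t|)%E ->
  (rearr alpha x t <= rearr alpha y t)%E.
Proof.
move=> mx my xy; apply: ereal_inf_le_tmp => _ [k [k0 dk] <-]; exists k => //.
by split => //; apply: le_trans dk; exact: le_distr_fun.
Qed.

Lemma measurable_antitone (f : R -> \bar R) :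
  (forall s t, s <= t -> (f t <= f s)%E) -> measurable_fun setT f.
Proof.
move=> af; apply: (measurability _ (ErealGenOInfty.measurableE R)) => _ [_ [r ->] <-].
rewrite setTI; apply: is_interval_measurable => s t/=.
rewrite !in_itv/= !andbT => fs ft u /andP[_ /af].
by rewrite in_itv/= andbT; exact: lt_le_trans.
Qed.

Lemma measurable_rearr x D : measurable D -> measurable_fun D (rearr alpha x).
Proof.
move=> mD; apply: (measurable_funS measurableT) => //.
by apply: measurable_antitone => s t; exact: rearr_antitone.
Qed.

Lemma L0_rearr x : L0 alpha (rearr alpha x).
Proof. by apply: measurable_rearr; exact: measurable_dom. Qed.

(** By [gt_rearr] the set where x* exceeds [l] is [0, d_x(l)), and d_x(l) <= alpha keeps it inside
    the domain. *)
Lemma distr_rearr x l : L0 alpha x -> 0 <= l ->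
  distr_fun alpha (rearr alpha x) l = distr_fun alpha x l.
Proof.
move=> mx l0; rewrite {1}/distr_fun.
set d := distr_fun alpha x l.
have d0 : (0 <= d)%E by exact: distr_fun_ge0.
case: (leP alpha 0%E) => [a0|a0].
  have dom0 : dom alpha = set0.
    apply/seteqP; split => // t [t0 ta]; have := lt_le_trans ta a0.
    by rewrite lte_fin ltNge t0.
  by rewrite /d /distr_fun dom0 !set0I.
have da : (d <= alpha)%E.
  rewrite -(lebesgue_measure_dom (ltW a0)); apply: le_measure; rewrite ?inE.
  - exact: measurable_distr_set.
  - exact: measurable_dom.
  - exact: subIsetl.
rewrite -[RHS]lebesgue_measure_dom//.
congr (mu _); apply/seteqP; split => t [].
  by move=> [t0 _] /=; rewrite gee0_abs ?rearr_ge0// gt_rearr.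
move=> t0 td; split; first by split => //; exact: lt_le_trans da.
by rewrite /= gee0_abs ?rearr_ge0// gt_rearr.
Qed.

Lemma rearr_rearr x : L0 alpha x -> rearr alpha (rearr alpha x) = rearr alpha x.
Proof. by move=> mx; apply: eq_rearr => l; exact: distr_rearr. Qed.

(** By [gt_rearr], exceeding a level [r] at [t] means t < d_x(r), which leaves room to increase [t].
    For an antitone function this amounts to right continuity. *)
Lemma rearr_rcont x t (q : \bar R) : L0 alpha x -> (q < rearr alpha x t)%E ->
  exists2 e : R, 0 < e & (q < rearr alpha x (t + e))%E.
Proof.
move=> mx; case: (ltP q 0%E) => [q0 _|q0 qt].
  by exists 1 => //; apply: (lt_le_trans q0); exact: rearr_ge0.
have [r [r0 qr rt]] := ge0_le_fin_lt q0 qt.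
move: rt; rewrite gt_rearr// => /lte_fin_between[s [ts sd]].
exists (s - t); first by rewrite subr_gt0 -lte_fin.
by rewrite addrC subrK (le_lt_trans qr)// gt_rearr.
Qed.

Lemma rearr_notin_dom x t : (0 <= alpha)%E -> L0 alpha x -> 0 <= t -> ~ dom alpha t ->
  rearr alpha x t = 0%E.
Proof.
move=> a0 mx t0 ndt; apply/eqP; rewrite eq_le rearr_ge0 andbT leNgt.
apply/negP; rewrite gt_rearr// => td; apply: ndt; split => //.
apply: (lt_le_trans td); rewrite -[leRHS]lebesgue_measure_dom//.
apply: le_measure; rewrite ?inE.
- exact: measurable_distr_set.
- exact: measurable_dom.
- exact: subIsetl.
Qed.

(** For [r >= f t] the set where [f] exceeds [r] lies in [0, t], so its measure is at most [t]. The
    inequality can be strict at a jump of [f]. *)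
Lemma rearr_antitone_le f t : (forall s t, s <= t -> (f t <= f s)%E) ->
  (forall s, 0 <= f s)%E -> 0 <= t -> (rearr alpha f t <= f t)%E.
Proof.
move=> af f0 t0; have mf : L0 alpha f.
  apply: (measurable_funS measurableT) => //; exact: measurable_antitone.
rewrite leNgt; apply/negP => /(ge0_le_fin_lt (f0 _))[r [r0 fr]].
rewrite gt_rearr//; apply/negP; rewrite -leNgt.
have -> : t%:E = mu `[0, t]%classic by rewrite lebesgue_measure_itv_le ?subr0.
apply: le_measure; rewrite ?inE; first exact: measurable_distr_set.
  exact: measurable_itv.
move=> s [[s0 _]/=]; rewrite gee0_abs// => rs; rewrite in_itv/= s0/=.
rewrite leNgt; apply/negP => /ltW /af.
by rewrite leNgt => /negP; apply; exact: le_lt_trans rs.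
Qed.

Lemma rearr_antitone_id f t : (forall s t, s <= t -> (f t <= f s)%E) ->
  (forall s, 0 <= f s)%E ->
  (forall q : \bar R, (q < f t)%E -> exists2 e : R, 0 < e & (q < f (t + e)%R)%E) ->
  dom alpha t -> rearr alpha f t = f t.
Proof.
move=> af f0 rc [t0 ta]; have mf : L0 alpha f.
  apply: (measurable_funS measurableT) => //; exact: measurable_antitone.
apply/eqP; rewrite eq_le rearr_antitone_le//= leNgt.
apply/negP => /(ge0_le_fin_lt (rearr_ge0 _ _))[r [r0 fr /rc[e e0 re]]].
have [a [ta' aa]] := lte_fin_between ta; rewrite lte_fin in ta'.
(* With [t + d <= a < alpha] the interval [[0, t + d[] lies in the domain, and [f > r] on it. *)
pose d := Num.min e (a - t).
have d0 : 0 < d by rewrite lt_min e0 subr_gt0.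
have dta : t + d <= a by rewrite -lerBrDl ge_min lexx orbT.
have rd : (r%:E < f (t + d)%R)%E.
  by apply: (lt_le_trans re); apply: af; rewrite lerD2l ge_min lexx.
move: fr; apply/negP; rewrite -ltNge gt_rearr//.
apply: (@lt_le_trans _ _ (mu `[0, t + d[%classic)).
  by rewrite lebesgue_measure_itv_le ?subr0 ?lte_fin ?ltrDl// addr_ge0// ltW.
apply: le_measure; rewrite ?inE; [exact: measurable_itv|exact: measurable_distr_set|].
move=> s /=; rewrite in_itv/= => /andP[s0 std]; split.
  split => //; apply: le_lt_trans aa; rewrite lee_fin; apply: le_trans dta; exact: ltW.
by rewrite /= gee0_abs//; apply: (lt_le_trans rd); apply: af; exact: ltW.
Qed.

End rearrangement.

(** * Banach function spaces *)

Section ae_domain.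
Context (R : realType) (alpha : \bar R).
Implicit Types P Q S : R -> Prop.

Lemma ae_domW P : (forall t, dom alpha t -> P t) -> ae_dom alpha P.
Proof. by move=> H; apply: aeW => t; exact: H. Qed.

Lemma ae_domS P Q : (forall t, dom alpha t -> P t -> Q t) ->
  ae_dom alpha P -> ae_dom alpha Q.
Proof.
move=> H; apply: negligibleS => t/= nQ Pt; apply: nQ => dt.
by apply: H => //; exact: Pt.
Qed.

Lemma ae_dom_countable (A : set R) P : countable A ->
  (forall t, dom alpha t -> ~ A t -> P t) -> ae_dom alpha P.
Proof.
move=> cA H; exists A; split.
- exact: countable_measurable.
- exact: countable_lebesgue_measure0.
- by move=> t/= nP; apply: contrapT => nA; apply: nP => dt; exact: H.
Qed.

Lemma ae_dom_gt0 P : (forall t, dom alpha t -> 0 < t -> P t) -> ae_dom alpha P.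
Proof.
move=> H; apply: (@ae_dom_countable [set 0]) => [|t dt /eqP t0]; first exact: countable1.
by apply: H => //; rewrite lt_neqAle eq_sym t0; case: dt.
Qed.

Lemma ae_dom_exists P (t : R) : ae_dom alpha P -> dom alpha t -> 0 < t ->
  exists s, [/\ 0 < s, s < t & P s].
Proof.
move=> [N [mN N0 HN]] dt t0; apply: contrapT => H.
have : (@lebesgue_measure R `]0%R, t[%classic <= @lebesgue_measure R N)%E.
  apply: (le_measure lebesgue_measure); rewrite ?inE//.
  move=> s/=; rewrite in_itv/= => /andP[s0 st]; apply: HN => /= Ps; apply: H.
  exists s; split => //; apply: Ps; apply: dom_le dt; exact: ltW.
rewrite lebesgue_measure_itv_le ?(ltW t0)// subr0 [X in (_ <= X)%E]N0 lee_fin.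
by rewrite leNgt t0.
Qed.

End ae_domain.

Section banach_function_space.
Context (R : realType) (alpha : \bar R) (E : banachFunctionSpace alpha).
Implicit Types x y z : R -> \bar R.
Local Notation mem := (bfs_mem E).
Local Notation norm := (bfs_norm E).

(** Solidity compares [x] with [0 * x], whose norm is 0 by homogeneity. *)
Lemma bfs_norm_ge0 x : mem x -> 0 <= norm x.
Proof.
move=> Ex; have E0 := bfs_scale 0 Ex.
rewrite (_ : 0 = norm (fun t => 0%:E * x t)%E); last first.
  by rewrite bfs_norm_scale// normr0 mul0r.
apply: (bfs_solid (bfs_L0 E0) Ex _).2; apply: ae_domW => t _.
by rewrite mul0e abse0 abse_ge0.
Qed.

Lemma bfs_mem_sub x y : mem x -> mem y -> mem (fun t => x t - y t)%E.
Proof.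
move=> Ex Ey; rewrite (_ : (fun t => _) = (fun t => x t + (-1)%:E * y t)%E).
  by apply: bfs_add => //; exact: bfs_scale.
by apply/funext => t; rewrite mulN1e.
Qed.

Lemma bfs_norm_subC x y : mem x -> mem y ->
  norm (fun t => x t - y t)%E = norm (fun t => y t - x t)%E.
Proof.
move=> Ex Ey; have Exy := bfs_mem_sub Ex Ey; have Eyx := bfs_mem_sub Ey Ex.
have ab t : `|x t - y t|%E = `|y t - x t|%E.
  by case: (x t) (y t) => [a| |] [b| |]//=; rewrite distrC.
apply/eqP; rewrite eq_le; apply/andP; split.
  by apply: (bfs_solid (bfs_L0 Exy) Eyx _).2; apply: ae_domW => t _; rewrite ab.
by apply: (bfs_solid (bfs_L0 Eyx) Exy _).2; apply: ae_domW => t _; rewrite ab.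
Qed.

Lemma bfs_norm_le_add x y z : L0 alpha z -> mem x -> mem y ->
  ae_dom alpha (fun t => `|z t| <= `|x t + y t|)%E ->
  mem z /\ norm z <= norm x + norm y.
Proof.
move=> mz Ex Ey H; have [Ez nz] := bfs_solid mz (bfs_add Ex Ey) H.
by split => //; apply: (le_trans nz); exact: bfs_norm_add.
Qed.

Hypothesis Efatou : fatou_property E.

(** The tail infima of the [f n] increase to the lower limit and have norm at most [C], so the Fatou
    property applies to them. This carries norm bounds over to pointwise lower limits. *)
Lemma bfs_fatou (f : nat -> R -> \bar R) x (C : R) :
  (forall n, mem (f n)) -> (forall n t, dom alpha t -> 0 <= f n t)%E ->
  (forall n, norm (f n) <= C) -> L0 alpha x -> (forall t, dom alpha t -> 0 <= x t)%E ->
  ae_dom alpha (fun t => x t <= limn_einf (f ^~ t))%E ->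
  mem x /\ norm x <= C.
Proof.
move=> Ef f0 fC mx x0 xf.
pose g n t := einfs (f ^~ t) n.
have mg n : L0 alpha (g n).
  by apply: measurable_fun_einfs => k; exact: (bfs_L0 (Ef k)).
have g0 n t : dom alpha t -> (0 <= g n t)%E.
  by move=> dt; apply: le_ereal_inf_tmp => _ [k _ <-]; exact: f0.
have gf n t : (g n t <= f n t)%E by apply: ereal_inf_lbound; exists n => /=.
have Eg n : mem (g n) /\ norm (g n) <= norm (f n).
  apply: bfs_solid => //; apply: ae_domW => t dt.
  by rewrite !gee0_abs ?f0 ?g0.
have cg t : g n t @[n --> \oo] --> limn_einf (f ^~ t).
  by rewrite limn_einf_lim; exact: is_cvg_einfs.
have mL : L0 alpha (fun t => limn_einf (f ^~ t)).
  by apply: emeasurable_fun_cvg mg _ => t _; exact: cg.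
have [El _ cn] : [/\ mem (fun t => limn_einf (f ^~ t)),
    (forall n, norm (g n) <= norm (g n.+1)) &
    norm (g n) @[n --> \oo] --> norm (fun t => limn_einf (f ^~ t))].
  apply: Efatou => //.
  - by move=> n; split; [exact: (Eg n).1|apply: ae_domW => t; exact: g0].
  - by exists C => n; apply: le_trans (fC n); exact: (Eg n).2.
  - by move=> n; apply: ae_domW => t _; exact: nondecreasing_einfs.
  - by apply: ae_domW => t _; exact: cg.
have [Ex nx] : mem x /\ norm x <= norm (fun t => limn_einf (f ^~ t)).
  apply: bfs_solid => //; apply: ae_domS xf => t dt xl.
  by rewrite !gee0_abs ?x0//; apply: le_trans xl; exact: x0.
split => //; apply: (le_trans nx); rewrite -(cvg_lim _ cn)//.
apply: limr_le; first by apply/cvg_ex; eexists; exact: cn.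
by apply: nearW => n; apply: le_trans (fC n); exact: (Eg n).2.
Qed.

Hypothesis Esym : symmetric_space E.

Lemma bfs_rearr x : mem x -> mem (rearr alpha x) /\ norm (rearr alpha x) = norm x.
Proof.
move=> Ex; apply: Esym => //; first exact: L0_rearr.
by move=> l l0; apply: distr_rearr => //; exact: bfs_L0 Ex.
Qed.

Lemma bfs_rearr_mem x : L0 alpha x -> mem (rearr alpha x) -> mem x.
Proof.
move=> mx Ex; apply: (Esym mx Ex _).1 => l l0; by rewrite distr_rearr.
Qed.

(** An infinite value at [t] would make x* infinite on [0, t[, a set of positive measure, against
    [bfs_fin]. *)
Lemma bfs_rearr_lty x t : mem x -> dom alpha t -> 0 < t -> (rearr alpha x t < +oo)%E.
Proof.
move=> Ex dt t0; rewrite ltey; apply/negP => /eqP xt.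
have [N [mN N0 H]] := bfs_fin (bfs_rearr Ex).1.
have : (t%:E <= @lebesgue_measure R N)%E.
  rewrite -[t in t%:E](subr0 t) -(@lebesgue_measure_itv_le _ _ _ true false (ltW t0)).
  apply: (le_measure lebesgue_measure); rewrite ?inE//.
  move=> s/=; rewrite in_itv/= => /andP[s0 st]; apply: H => /= H.
  have : rearr alpha x s \is a fin_num by apply: H; apply: dom_le dt.
  rewrite fin_numE => /andP[_ /eqP]; apply; apply/eqP; rewrite -leye_eq -xt.
  exact: rearr_antitone.
by rewrite [X in (_ <= X)%E]N0 lee_fin leNgt t0.
Qed.

End banach_function_space.

(** * Weak majorization of vectors and of step functions *)

(** Induction on the number of indices where [a] and [b] differ, which each T-transform lowers; once
    [a <= b] everywhere, solidity concludes. A general [P] lets membership and the norm bound travel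
    together. *)
Lemma weak_majorization_ind (R : realFieldType) (n : nat)
    (P : ('I_n -> R) -> Prop) (a : 'I_n -> R) :
  (forall b c : 'I_n -> R, (forall i, 0 <= c i) -> (forall i, c i <= b i) -> P b -> P c) ->
  (forall (b : 'I_n -> R) i j (r : R), 0 <= r <= 1 -> (forall k, 0 <= b k) -> P b ->
    P (fun k => (1 - r) * b k + r * b (tperm i j k))) ->
  (forall i, 0 <= a i) -> (forall i j : 'I_n, (i <= j)%N -> a j <= a i) ->
  forall b : 'I_n -> R, (forall i, 0 <= b i) -> P b ->
  (forall m, (m <= n)%N ->
    \sum_(i < n | (i < m)%N) a i <= \sum_(i < n | (i < m)%N) b i) ->
  P a.
Proof.
move=> Psolid Ptransf a0 aanti b b0 Pb ab.
have [N] := ubnP #|[set i | a i != b i]%SET|.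
elim: N b b0 Pb ab => // N IHN b b0 Pb ab; rewrite ltnS => cardN.
have [/existsP[k0 bak0]|] := boolP [exists k, b k < a k]; last first.
  move=> /existsPn H; apply: (Psolid b) => // i; rewrite leNgt; exact: H.
(* Mass d is moved from j to k, where k is the first index at which a exceeds b
   and j the last one before k at which b exceeds a. Strictly between them a and
   b agree, and after the move they agree at j or at k as well. *)
have [k bak kmin] := @arg_minnP _ k0 (fun k => b k < a k) (fun k => val k) bak0.
(* Otherwise [b <= a] before [k] and [b k < a k], and the partial sums up to [k] would violate the
   majorization. *)
have [j0 j0k] : exists j0 : 'I_n, (j0 < k)%N && (a j0 < b j0).
  apply/existsP; apply: contrapT => /negP /existsPn H.
  have := ab k.+1 (ltn_ord k); apply/negP; rewrite -ltNge.
  rewrite (bigD1 k)//= [ltRHS](bigD1 k)//=; apply: ltr_leD => //.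
  apply: ler_sum => i /andP[ik nik].
  have ik' : (i < k)%N by rewrite ltn_neqAle -ltnS ik andbT.
  by move: (H i); rewrite ik'/= -leNgt.
have [j /andP[jk abj] jmax] :=
  @arg_maxnP _ j0 (fun j => (j < k)%N && (a j < b j)) (fun j => val j) j0k.
have ajk : a k <= a j by apply: aanti; exact: ltnW.
have aeqb (i : 'I_n) : (j < i)%N -> (i < k)%N -> a i = b i.
  move=> ji ik; apply/eqP; rewrite eq_le; apply/andP; split.
    by rewrite leNgt; apply/negP => /kmin /=; rewrite leqNgt ik.
  rewrite leNgt; apply/negP => abi; have := jmax i.
  by rewrite ik abi => /(_ isT)/=; rewrite leqNgt ji.
pose d := Num.min (b j - a j) (a k - b k).
have d0 : 0 < d by rewrite lt_min !subr_gt0 abj bak.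
have dj : d <= b j - a j by rewrite ge_min lexx.
have dk : d <= a k - b k by rewrite ge_min lexx orbT.
have bjk : d <= b j - b k by lra.
have bjk0 : 0 < b j - b k by lra.
(* The weight of the exchanged vector for which exactly the mass [d] moves; it is at most 1 because
   [b k < a k <= a j < b j]. *)
pose r := d / (b j - b k).
have rd : r * (b j - b k) = d by rewrite /r divfK// gt_eqF.
have r01 : 0 <= r <= 1 by rewrite divr_ge0 ?(ltW d0) ?(ltW bjk0)//= ler_pdivrMr// mul1r.
pose b' i := (1 - r) * b i + r * b (tperm j k i).
have b'j : b' j = b j - d by rewrite /b' tpermL -rd; ring.
have b'k : b' k = b k + d by rewrite /b' tpermR -rd; ring.
have b'E i : i != j -> i != k -> b' i = b i.
  by move=> ij ik; rewrite /b' tpermD 1?eq_sym//; ring.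
apply: (IHN b').
- move=> i; have [->|ij] := eqVneq i j.
    by rewrite b'j; have := a0 j; lra.
  have [->|ik] := eqVneq i k; first by rewrite b'k; have := b0 k; lra.
  by rewrite b'E.
- exact: Ptransf.
(* For [m > k] the partial sums of [b'] and [b] coincide. For [m <= k] the entries before [j] are
   unchanged, so the old inequality at min(m, j) covers them, and from [j] on [a <= b'] holds
   termwise. *)
- move=> m mn; have [km|mk] := ltnP k m.
    rewrite (_ : \sum_(i < n | (i < m)%N) b' i = \sum_(i < n | (i < m)%N) b i).
      exact: ab.
    rewrite big_split/= -!mulr_sumr [X in _ + _ * X](_ : _ = \sum_(i < n | (i < m)%N) b i).
      by ring.
    rewrite [RHS](reindex_inj (@perm_inj _ (tperm j k)))/=; apply: eq_bigl => i.
    by case: tpermP => // ->; rewrite ?km ?(ltn_trans jk km).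
  rewrite (bigID (fun i : 'I_n => (i < j)%N))/= [leRHS](bigID (fun i : 'I_n => (i < j)%N))/=.
  apply: lerD.
    rewrite [leRHS](eq_bigr b); last first.
      move=> i /andP[_ ij]; apply: b'E; apply/eqP => eij; move: ij.
        by rewrite eij ltnn.
      by rewrite eij ltnNge (ltnW jk).
    have [jm|mj] := leqP j m.
      have E (c : 'I_n -> R) : \sum_(i < n | (i < m)%N && (i < j)%N) c i =
          \sum_(i < n | (i < j)%N) c i.
        apply: eq_bigl => i; apply: andb_idl => ij; exact: leq_trans jm.
      by rewrite !E; apply: ab; exact: ltnW.
    have E (c : 'I_n -> R) : \sum_(i < n | (i < m)%N && (i < j)%N) c i =
        \sum_(i < n | (i < m)%N) c i.
      apply: eq_bigl => i; apply: andb_idr => ij; exact: ltn_trans mj.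
    by rewrite !E; exact: ab.
  apply: ler_sum => i /andP[im]; rewrite -leqNgt leq_eqVlt => /orP[/eqP/val_inj <-|ji].
    by rewrite b'j; lra.
  have ik : (i < k)%N by exact: leq_trans mk.
  rewrite b'E ?aeqb//; apply/eqP => eij; first by rewrite eij ltnn in ji.
  by rewrite eij ltnn in ik.
- apply: leq_trans cardN; apply: proper_card; apply/properP; split.
    apply/fintype.subsetP => i; rewrite !finset.inE => abi.
    have [->|ij] := eqVneq i j; first by rewrite lt_eqF.
    have [->|ik] := eqVneq i k; first by rewrite gt_eqF.
    by rewrite -b'E.
  have [dE|dE] : d = b j - a j \/ d = a k - b k.
    by rewrite /d; case: leP => _; [left|right].
  + exists j; first by rewrite finset.inE lt_eqF.
    by rewrite finset.inE b'j dE negbK; apply/eqP; ring.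
  + exists k; first by rewrite finset.inE gt_eqF.
    by rewrite finset.inE b'k dE negbK; apply/eqP; ring.
Qed.

Definition grid_cell (R : realType) (h : R) (i : nat) : set R :=
  `[i%:R * h, i.+1%:R * h[%classic.

(** Being linear in [b], it turns convex combinations of vectors into convex combinations of
    functions. *)
Definition grid_step (R : realType) (h : R) (n : nat) (b : 'I_n -> R) (t : R) : \bar R :=
  (\sum_(i < n) b i * \1_(grid_cell h i) t)%:E.

Section grid_step.
Context (R : realType) (h : R) (n : nat).
Hypothesis h0 : 0 < h.
Implicit Types (b : 'I_n -> R) (s t : R).
Local Notation cell := (grid_cell h).
Local Notation step := (@grid_step R h n).

Lemma measurable_grid_cell i : measurable (cell i).
Proof. exact: measurable_itv. Qed.

Lemma lebesgue_measure_grid_cell i : @lebesgue_measure R (cell i) = h%:E.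
Proof.
rewrite lebesgue_measure_itv_le ?ler_pM2r ?ler_nat//.
by rewrite -mulrBl -natrB// subSnn mul1r.
Qed.

Lemma grid_cell_inj i j t : cell i t -> cell j t -> i = j.
Proof.
rewrite /grid_cell /= !in_itv/= => /andP[it ti] /andP[jt tj].
have := le_lt_trans it tj; rewrite ltr_pM2r// ltr_nat ltnS => ij.
have := le_lt_trans jt ti; rewrite ltr_pM2r// ltr_nat ltnS => ji.
by apply/eqP; rewrite eqn_leq ij.
Qed.

Lemma grid_cell_exists t : 0 <= t -> t < n%:R * h -> exists i : 'I_n, cell i t.
Proof.
move=> t0 tn; have th0 : 0 <= t / h by rewrite divr_ge0// ltW.
have /andP[] := truncn_itv th0.
rewrite ler_pdivlMr// ltr_pdivrMr// => tr1 tr2.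
have k : (Num.trunc (t / h) < n)%N.
  by have := le_lt_trans tr1 tn; rewrite ltr_pM2r// ltr_nat.
by exists (Ordinal k); rewrite /grid_cell/= in_itv/= tr1.
Qed.

Lemma grid_stepE b (i : 'I_n) t : cell i t -> step b t = (b i)%:E.
Proof.
move=> it; rewrite /grid_step (bigD1 i)//= indicE mem_set// mulr1 big1 ?addr0//.
move=> j ji; rewrite indicE memNset ?mulr0// => jt.
by move/eqP: ji; apply; apply/val_inj; exact: grid_cell_inj jt it.
Qed.

Lemma grid_step_out b t : (forall i : 'I_n, ~ cell i t) -> step b t = 0%E.
Proof.
move=> nt; rewrite /grid_step big1// => i _; rewrite indicE memNset ?mulr0//.
Qed.

Lemma grid_step_itv b t (P : \bar R -> Prop) :
  P 0%E -> (forall i : 'I_n, cell i t -> P (b i)%:E) -> P (step b t).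
Proof.
move=> P0 Pb; have [[i it]|nt] := pselect (exists i : 'I_n, cell i t).
  by rewrite (grid_stepE _ it); exact: Pb.
by rewrite grid_step_out// => i it; apply: nt; exists i.
Qed.

Lemma grid_step_ge0 b t : (forall i, 0 <= b i) -> (0 <= step b t)%E.
Proof. by move=> b0; apply: (@grid_step_itv _ _ (fun y => 0 <= y)%E) => // i _; rewrite lee_fin. Qed.

Lemma measurable_grid_step b D : measurable D -> measurable_fun D (step b).
Proof.
move=> mD; apply/measurable_EFinP; apply: measurable_sum => i.
by apply: measurable_funM => //; apply: measurable_indic; exact: measurable_grid_cell.
Qed.

(** The cells are disjoint and of equal measure, so only the multiset of values matters: permuting
    [b] keeps the distribution function, hence any symmetric norm. *)
Lemma distr_grid_step (alpha : \bar R) b l : ((n%:R * h)%:E <= alpha)%E ->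
  (forall i, 0 <= b i) -> 0 <= l ->
  distr_fun alpha (step b) l = (\sum_(i < n | (l < b i)%R) h%:E)%E.
Proof.
move=> na b0 l0; rewrite /distr_fun.
rewrite (_ : _ `&` _ = \big[setU/set0]_(i < n | l < b i) cell i).
  rewrite measure_bigsetU_ord//.
    by apply: eq_bigr => i _; exact: lebesgue_measure_grid_cell.
    by move=> i; exact: measurable_grid_cell.
  by move=> i j _ _ [t [it jt]]; apply/val_inj; exact: grid_cell_inj it jt.
rewrite -bigcup_seq_cond; apply/seteqP; split => t.
  move=> [dt]; rewrite /mkset gee0_abs ?grid_step_ge0//.
  apply: (@grid_step_itv _ _ (fun y => (l%:E < y)%E -> _)).
    by rewrite lte_fin ltNge l0.
  move=> i it; rewrite lte_fin => li; exists i => //=.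
  by rewrite mem_index_enum.
move=> [i /= /andP[_ li] it]; split.
  move: it; rewrite /grid_cell/= in_itv/= => /andP[it ti]; split.
    by apply: le_trans it; rewrite mulr_ge0// ltW.
  apply: lt_le_trans na; rewrite lte_fin; apply: (lt_le_trans ti).
  by rewrite ler_pM2r// ler_nat.
suff : (l%:E < `|step b t|)%E by [].
by rewrite (grid_stepE _ it) /= lte_fin ger0_norm.
Qed.

Variables (alpha : \bar R) (E : banachFunctionSpace alpha).
Hypothesis Esym : symmetric_space E.

(** Both closure conditions of [weak_majorization_ind] hold for the norm bound: solidity gives the
    first, while symmetry and the triangle inequality give the second. *)
Lemma grid_step_majorization (a b : 'I_n -> R) : ((n%:R * h)%:E <= alpha)%E ->
  (forall i, 0 <= a i) -> (forall i j : 'I_n, (i <= j)%N -> a j <= a i) ->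
  (forall i, 0 <= b i) ->
  (forall m, (m <= n)%N ->
    \sum_(i < n | (i < m)%N) a i <= \sum_(i < n | (i < m)%N) b i) ->
  bfs_mem E (step b) ->
  bfs_mem E (step a) /\ bfs_norm E (step a) <= bfs_norm E (step b).
Proof.
move=> na a0 aanti b0 ab Eb.
have mstep c : L0 alpha (step c) by apply: measurable_grid_step; exact: measurable_dom.
pose P c := bfs_mem E (step c) /\ bfs_norm E (step c) <= bfs_norm E (step b).
apply: (@weak_majorization_ind _ _ P _ _ _ a0 aanti b b0 _ ab) => //.
  move=> c d d0 dc [Ec nc].
  have [] := @bfs_solid _ _ E (step d) (step c) (mstep d) Ec.
    apply: ae_domW => t _; have c0 i : 0 <= c i by exact: le_trans (dc i).
    rewrite !gee0_abs ?grid_step_ge0// lee_fin; apply: ler_sum => i _.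
    by rewrite ler_wpM2r.
  by move=> Ed nd; split => //; exact: le_trans nc.
move=> c i j r /andP[r0 r1] c0 [Ec nc].
pose c' k := c (tperm i j k).
have [Ec' nc'] : bfs_mem E (step c') /\ bfs_norm E (step c') = bfs_norm E (step c).
  apply: Esym => // l l0; rewrite !distr_grid_step// => [|k]; last exact: c0.
  by rewrite [RHS](reindex_inj (@perm_inj _ (tperm i j))).
rewrite /P (_ : step _ = (fun t => (1 - r)%:E * step c t + r%:E * step c' t)%E).
  have E1 := bfs_scale (1 - r) Ec; have E2 := bfs_scale r Ec'.
  split; first exact: bfs_add.
  apply: (le_trans (bfs_norm_add E1 E2)); rewrite !bfs_norm_scale// nc'.
  by rewrite !ger0_norm ?subr_ge0//; have := bfs_norm_ge0 Ec; nra.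
apply/funext => t; rewrite /grid_step -!EFinM -EFinD !mulr_sumr -big_split/=.
by congr EFin; apply: eq_bigr => k _; rewrite /c'; ring.
Qed.

End grid_step.

(** * Primitives of decreasing functions *)

HB.lock Definition prim (R : realType) (f : R -> \bar R) (t : R) : \bar R :=
  \int[@lebesgue_measure R]_(s in `[0, t]) f s.

Section primitive.
Context (R : realType) (f : R -> \bar R).
Local Notation mu := (@lebesgue_measure R).
Hypothesis f_anti : forall s t, s <= t -> (f t <= f s)%E.
Hypothesis f_ge0 : forall t, (0 <= f t)%E.

Let mf D : measurable D -> measurable_fun D f.
Proof. by move=> mD; apply: (measurable_funS measurableT) => //; exact: measurable_antitone. Qed.

Lemma integral_itv_split (a : itv_bound R) (s t : R) :
  (a <= BRight s)%O -> s <= t ->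
  (\int[mu]_(u in [set` Interval a (BRight t)]) f u =
   \int[mu]_(u in [set` Interval a (BRight s)]) f u + \int[mu]_(u in `]s, t]) f u)%E.
Proof.
move=> sa st; rewrite (@itv_bndbnd_setU _ _ a (BRight s)) ?bnd_simp//.
rewrite ge0_integral_setU//=.
- by apply: mf; exact: measurableU.
- apply/disj_setPS => u [] /=; rewrite !itv_boundlr => /andP[_ us] /andP[su _].
  by have := le_trans us su; rewrite bnd_simp ltxx.
Qed.

Lemma integral_itv_le (s t : R) (b : bool) : s <= t ->
  (\int[mu]_(u in [set` Interval (BSide b s) (BRight t)]) f u <= f s * (t - s)%:E)%E.
Proof.
move=> st; rewrite -(@lebesgue_measure_itv_le _ _ _ b false st) -integral_cst//.
apply: ge0_le_integral => //; first exact: mf.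
by move=> u/=; rewrite itv_boundlr => /andP[su _]; apply: f_anti; case: b su; rewrite bnd_simp => // /ltW.
Qed.

Lemma integral_itv_ge (s t : R) (b : bool) : s <= t ->
  (f t * (t - s)%:E <= \int[mu]_(u in [set` Interval (BSide b s) (BRight t)]) f u)%E.
Proof.
move=> st; rewrite -(@lebesgue_measure_itv_le _ _ _ b false st) -integral_cst//.
apply: ge0_le_integral => //; [by move=> u _; exact: f_ge0|exact: mf|].
by move=> u/=; rewrite itv_boundlr => /andP[_]; rewrite bnd_simp; exact: f_anti.
Qed.

Lemma prim_ge0 t : (0 <= prim f t)%E.
Proof. by rewrite prim.unlock; exact: integral_ge0. Qed.

Lemma prim_split s t : 0 <= s -> s <= t ->
  prim f t = (prim f s + \int[mu]_(u in `]s, t]) f u)%E.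
Proof. by move=> s0 st; rewrite prim.unlock (@integral_itv_split _ s) ?bnd_simp. Qed.

Lemma prim_le s t : s <= t -> (prim f s <= prim f t)%E.
Proof.
move=> st; rewrite prim.unlock; apply: ge0_subset_integral => //; first exact: mf.
by apply: subset_itvl; rewrite bnd_simp.
Qed.

Lemma prim_le_add s t : 0 <= s -> s <= t ->
  (prim f t <= prim f s + f s * (t - s)%:E)%E.
Proof. by move=> s0 st; rewrite (prim_split s0 st) leeD2l// integral_itv_le. Qed.

Lemma prim_ge_add s t : 0 <= s -> s <= t ->
  (prim f s + f t * (t - s)%:E <= prim f t)%E.
Proof. by move=> s0 st; rewrite (prim_split s0 st) leeD2l// integral_itv_ge. Qed.

Lemma prim_ge_mul t : 0 <= t -> (f t * t%:E <= prim f t)%E.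
Proof.
by move=> t0; have := @integral_itv_ge 0 t true t0; rewrite subr0 prim.unlock.
Qed.

(** The integrals over []t/(n+2), t]] increase to the primitive at [t]. The form with a real [r]
    also covers an infinite primitive. *)
Lemma prim_approx (r t : R) : 0 < t -> (r%:E < prim f t)%E ->
  exists2 h, 0 < h < t & (r%:E < \int[mu]_(u in `]h, t]) f u)%E.
Proof.
move=> t0 rt.
pose F n : set R := `]t / n.+2%:R, t]%classic.
have UF : \bigcup_n F n = `]0, t]%classic.
  apply/seteqP; split => u.
    move=> [n _]; rewrite /F/= !in_itv/= => /andP[nu ->].
    by rewrite andbT (le_lt_trans _ nu)// divr_ge0// ltW.
  rewrite /= in_itv/= => /andP[u0 ut].
  have [n nu] := ltr_add_invr (divr_gt0 u0 t0 : 0 < u / t).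
  exists n => //; rewrite /F/= in_itv/= ut andbT; rewrite add0r in nu.
  have : t * n.+1%:R^-1 < u by rewrite -ltr_pdivlMl// mulrC.
  by apply: le_lt_trans; rewrite ler_pM2l// lef_pV2 ?posrE// ler_nat.
have cF : (\int[mu]_(u in F n) f u)%E @[n --> \oo] --> prim f t.
  rewrite prim.unlock -integral_itv_obnd_cbnd; last first.
    by apply: mf; exact: measurable_itv.
  rewrite -UF; apply: ge0_nondecreasing_set_cvg_integral => //.
  - move=> n m nm; apply/subsetPset; apply: subset_itvr; rewrite bnd_simp.
    by rewrite ler_pM2l// lef_pV2 ?posrE// ler_nat.
  - by move=> n; exact: measurable_itv.
  - by move=> n; apply: mf; exact: measurable_itv.
have [n rn] : exists n, (r%:E < \int[mu]_(u in F n) f u)%E.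
  apply: contrapT => H; have := rt; apply/negP; rewrite -leNgt -(cvg_lim _ cF)//.
  apply: lime_le; first by apply/cvg_ex; eexists; exact: cF.
  by apply: nearW => n; rewrite leNgt; apply/negP => ?; apply: H; exists n.
exists (t / n.+2%:R) => //; rewrite divr_gt0//= ltr_pdivrMr//.
by rewrite ltr_pMr// ltr1n.
Qed.

Lemma prim_small (t e : R) : 0 < t -> (prim f t < +oo)%E -> 0 < e ->
  exists2 h, 0 < h < t & (prim f h <= e%:E)%E.
Proof.
move=> t0 ft e0; have ff : prim f t \is a fin_num by rewrite ge0_fin_numE// prim_ge0.
have [|h /andP[h0 ht] H] := @prim_approx (fine (prim f t) - e) t t0.
  by rewrite -[ltRHS]fineK// lte_fin ltrBlDr ltrDl.
exists h; first by rewrite h0.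
rewrite leNgt; apply/negP => eh; have := lteD eh H.
by rewrite -(prim_split (ltW h0) (ltW ht)) -EFinD addrC subrK fineK// ltxx.
Qed.

Lemma prim_grid_le (h : R) k : 0 < h ->
  (\sum_(i < k) f (i.+1%:R * h) * h%:E <= prim f (k%:R * h))%E.
Proof.
move=> h0; elim: k => [|k IH]; first by rewrite big_ord0 prim_ge0.
rewrite big_ord_recr/=; have kS : k.+1%:R * h - k%:R * h = h.
  by rewrite -mulrBl -natrB// subSnn mul1r.
have k0 : 0 <= k%:R * h by rewrite mulr_ge0// ltW.
have kk : k%:R * h <= k.+1%:R * h by rewrite ler_pM2r// ler_nat.
by apply: le_trans (prim_ge_add k0 kk); rewrite kS leeD2r.
Qed.

(** On each cell [f] is at most its value at the left endpoint, which is the sample point of the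
    preceding cell. The sums of [prim_grid_le] thus miss at most the integral over [0, h]. *)
Lemma prim_grid_ge (h : R) k : 0 < h ->
  (\int[mu]_(u in `]h, (k.+1%:R * h)%R]) f u <= \sum_(i < k) f (i.+1%:R * h) * h%:E)%E.
Proof.
move=> h0; elim: k => [|k IH].
  by rewrite big_ord0 mul1r set_itv_ge ?integral_set0// bnd_simp ltxx.
rewrite big_ord_recr/= (@integral_itv_split _ (k.+1%:R * h)) ?bnd_simp.
- apply: leeD => //; have kS : k.+2%:R * h - k.+1%:R * h = h.
    by rewrite -mulrBl -natrB// subSnn mul1r.
  have := @integral_itv_le (k.+1%:R * h) (k.+2%:R * h) false.
  by rewrite kS; apply; rewrite ler_pM2r// ler_nat.
- by rewrite ler_pMl// ler1n.
- by rewrite ler_pM2r// ler_nat.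
Qed.

End primitive.

(** * K-monotonicity *)

Lemma limn_einf_ge (R : realType) (u : nat -> \bar R) (q : \bar R) N :
  (forall m, (N <= m)%N -> (q <= u m)%E) -> (q <= limn_einf u)%E.
Proof.
move=> qu; rewrite limn_einf_lim; apply: lime_ge; first exact: is_cvg_einfs.
near=> n; apply: le_ereal_inf_tmp => _ [k /= nk <-]; apply: qu.
by apply: leq_trans nk; near: n; exists N.
Unshelve. all: by end_near. Qed.

Lemma exists_fraction_le (R : realType) (T e : R) : 0 < T -> 0 < e ->
  exists2 n : nat, (0 < n)%N & T / n%:R <= e.
Proof.
move=> T0 e0; have [n] := ltr_add_invr (divr_gt0 e0 T0 : 0 < e / T).
rewrite add0r => ne; exists n.+1 => //.
by rewrite -ler_pdivlMl// mulrC ltW.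
Qed.

(** Here [Q <= e * k <= e * P]: a small loss [Q] near the origin is paid for by the factor
    [1 - e]. *)
Lemma lee_absorb (R : realType) (e k : R) (P Q I : \bar R) : 0 < e ->
  (0 <= Q)%E -> (0 <= I)%E -> (Q <= (e * k)%:E)%E -> (k%:E <= P)%E ->
  P \is a fin_num -> (P <= Q + I)%E -> ((1 - e)%:E * P <= I)%E.
Proof.
move=> e0; case: P Q I => [P| |] [Q| |] [I| |]//= _ _; rewrite ?leey//.
by rewrite -EFinM -EFinD !lee_fin => Qe kP _ PQI; nra.
Qed.

Section K_monotone.
Context (R : realType) (alpha : \bar R) (E : banachFunctionSpace alpha).
Hypothesis Esym : symmetric_space E.
Hypothesis Efatou : fatou_property E.
Hypothesis alpha1 : (1 <= alpha)%E.
Implicit Types x y : R -> \bar R.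
Local Notation mem := (bfs_mem E).
Local Notation norm := (bfs_norm E).
Local Notation mu := (@lebesgue_measure R).
Local Notation rr := (rearr alpha).

Let alpha0 : (0 <= alpha)%E.
Proof. by apply: le_trans alpha1. Qed.

Lemma rearr_fin x t : mem x -> 0 < t -> rr x t \is a fin_num.
Proof.
move=> Ex t0; rewrite ge0_fin_numE ?rearr_ge0//.
have [dt|ndt] := pselect (dom alpha t); first exact: bfs_rearr_lty Ex dt t0.
by rewrite rearr_notin_dom//; [exact: bfs_L0 Ex|exact: ltW].
Qed.

Lemma grid_step_rearr y h n : mem y -> 0 < h -> ((n%:R * h)%:E <= alpha)%E ->
  let b := fun i : 'I_n => fine (rr y (i.+1%:R * h)) in
  mem (grid_step h b) /\ norm (grid_step h b) <= norm y.
Proof.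
move=> Ey h0 na b; have [Ery <-] := bfs_rearr Esym Ey.
have b0 i : 0 <= b i by rewrite fine_ge0// rearr_ge0.
apply: bfs_solid => //; first by apply: measurable_grid_step; exact: measurable_dom.
apply: ae_domW => t dt; rewrite !gee0_abs ?rearr_ge0 ?grid_step_ge0//.
apply: (@grid_step_itv _ _ _ h0 _ _ (fun z => z <= rr y t)%E); first exact: rearr_ge0.
move=> i; rewrite /grid_cell/= in_itv/= => /andP[_ /ltW ti].
rewrite fineK ?rearr_antitone// rearr_fin//.
by rewrite mulr_gt0.
Qed.

(** The samples of [g] are weakly majorized by those of y*. Up to [d] this is termwise, from
    [g <= y*(d)]. Past [d], the sums for [g] are at most its primitive and those for y* at least the
    integral from [h] on; omitting [0, h1] with [h <= h1] leaves room for this discretization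
    error. *)
Lemma grid_step_le_rearr y (g : R -> R) h n (d h1 : R) : mem y -> 0 < h ->
  ((n%:R * h)%:E <= alpha)%E ->
  (forall s t, s <= t -> g t <= g s) -> (forall t, 0 <= g t) ->
  h <= h1 -> h1 < d -> (forall s, 0 < s -> ((g s)%:E <= rr y d)%E) ->
  (forall t, d <= t -> t <= n%:R * h ->
    (prim (EFin \o g) t <= \int[mu]_(u in `]h1, t]) rr y u)%E) ->
  let a := fun i : 'I_n => g (i.+1%:R * h) in
  mem (grid_step h a) /\ norm (grid_step h a) <= norm y.
Proof.
move=> Ey h0 na ganti g0 hh1 h1d gd gint a.
have [Eb nb] := grid_step_rearr Ey h0 na.
set b := fun i => _ in Eb nb.
have [||||Ea na'] := @grid_step_majorization _ h n h0 _ E Esym a b na _ _ _ _ Eb.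
- by move=> i; exact: g0.
- by move=> i j ij; apply: ganti; rewrite ler_pM2r// ler_nat.
- by move=> i; rewrite fine_ge0// rearr_ge0.
- move=> m mn.
  rewrite -(big_ord_widen _ (fun i => g (i.+1%:R * h)) mn).
  rewrite -(big_ord_widen _ (fun i => fine (rr y (i.+1%:R * h))) mn).
  have ryfin i : rr y (i.+1%:R * h) \is a fin_num by rewrite rearr_fin// mulr_gt0.
  have [md|dm] := leP (m%:R * h) d.
    apply: ler_sum => i _; rewrite -lee_fin fineK//.
    apply: le_trans (gd _ _) _; first by rewrite mulr_gt0.
    apply: rearr_antitone; apply: le_trans md; by rewrite ler_pM2r// ler_nat.
  rewrite -(ler_pM2r h0) !mulr_suml -lee_fin -!sumEFin.
  have g_anti s t : s <= t -> ((EFin \o g) t <= (EFin \o g) s)%E.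
    by move=> st; rewrite lee_fin ganti.
  have gge0 t : (0 <= (EFin \o g) t)%E by rewrite lee_fin.
  have -> : (\sum_(i < m) (g (i.+1%:R * h) * h)%:E)%E =
      (\sum_(i < m) (EFin \o g) (i.+1%:R * h)%R * h%:E)%E.
    by apply: eq_bigr => i _; rewrite EFinM.
  apply: le_trans (prim_grid_le g_anti gge0 m h0) _.
  apply: le_trans (gint _ (ltW dm) _) _; first by rewrite ler_pM2r// ler_nat.
  have -> : (\sum_(i < m) (fine (rr y (i.+1%:R * h)) * h)%:E)%E =
      (\sum_(i < m) rr y (i.+1%:R * h)%R * h%:E)%E.
    by apply: eq_bigr => i _; rewrite EFinM fineK.
  apply: le_trans (prim_grid_ge (@rearr_antitone _ alpha y) (@rearr_ge0 _ alpha y) m h0).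
  apply: ge0_subset_integral => //; try exact: measurable_itv.
  + by apply: measurable_rearr; exact: measurable_itv.
  + by move=> u _; exact: rearr_ge0.
  + move=> u/=; rewrite !in_itv/= => /andP[hu um]; rewrite (le_lt_trans hh1 hu)/=.
    by apply: (le_trans um); rewrite ler_pM2r// ler_nat.
- by split => //; exact: le_trans nb.
Qed.

(** If the primitive were infinite, every constant [c] on [0, 1) could be majorized on a fine enough
    grid, so the indicator of [0, 1) times any [c] would have norm at most that of [y]. The
    indicator would then have norm 0. *)
Lemma prim_rearr_lty y t : mem y -> (prim (rr y) t < +oo)%E.
Proof.
move=> Ey; have yanti := @rearr_antitone _ alpha y; have yge0 := @rearr_ge0 _ alpha y.
rewrite ltNge leye_eq; apply/negP => /eqP yt.
(* Since y* is finite at [d], all the infinite mass sits in [0, d]. *)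
have y1 d : 0 < d -> d <= 1 -> prim (rr y) d = +oo%E.
  move=> d0 d1; apply/eqP; rewrite -leye_eq -yt.
  have [td|dt] := leP t d; first exact: prim_le.
  have := prim_le_add yanti yge0 (ltW d0) (ltW dt); rewrite yt leye_eq.
  rewrite -(fineK (rearr_fin Ey d0)) -EFinM.
  by case: (prim (rr y) d).
pose chi (c : R) := grid_step 1 (fun _ : 'I_1 => c).
have chiE c s : 0 <= s -> s < 1 -> chi c s = c%:E.
  move=> s0 s1; rewrite /chi (@grid_stepE _ _ _ ltr01 _ ord0)//.
  by rewrite /grid_cell/= in_itv/= mul0r mulr1 s0.
have chi0 c s : ~ (0 <= s < 1) -> chi c s = 0%E.
  move=> ns; rewrite /chi grid_step_out// => i.
  by rewrite /grid_cell/= in_itv/= ord1 mul0r mulr1.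
have mchi c : L0 alpha (chi c) by apply: measurable_grid_step; exact: measurable_dom.
have H c : 0 < c -> mem (chi c) /\ norm (chi c) <= norm y.
  move=> c0.
  (* Two cuts are made: [h0] ensures that y* is at least [c] at [h0], and [h1] that the integral
     over []h1, h0]] exceeds [c], the whole mass of the constant on [0, 1]. *)
  have [h0 /andP[h00 h01]] : exists2 h, 0 < h < 1 &
      (c%:E < \int[mu]_(u in `]h, 1%R]) rr y u)%E.
    by apply: prim_approx => //; rewrite y1// ltry.
  move=> /lt_le_trans/(_ (integral_itv_le yanti yge0 false (ltW h01))) cy.
  have cyh : (c%:E <= rr y h0)%E.
    rewrite ltW// (lt_le_trans cy)// -[leRHS]mule1 lee_wpmul2l//.
    by rewrite lee_fin gerBl ltW.
  have [h1 /andP[h10 h1h0] ch1] : exists2 h1, 0 < h1 < h0 &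
      (c%:E < \int[mu]_(u in `]h1, h0]) rr y u)%E.
    by apply: prim_approx => //; rewrite y1// ?ltry// ltW.
  have [n n0 nh] := @exists_fraction_le R 1 h1 ltr01 h10.
  have h'0 : (0 : R) < 1 / n%:R by rewrite divr_gt0// ltr0n.
  have nn1 : n%:R * (1 / n%:R) = 1 :> R by rewrite mulrC divfK// pnatr_eq0 -lt0n.
  have [| | | | |Es ns] := @grid_step_le_rearr y (fun=> c) (1 / n%:R) n h0 h1 Ey h'0 _ _ _ nh h1h0 _ _.
  - by rewrite nn1.
  - by [].
  - by move=> _; exact: ltW.
  - by move=> s _; exact: cyh.
  - rewrite nn1 => s h0s s1; apply: (@le_trans _ _ c%:E).
      have s0 : 0 <= s by apply: le_trans h0s; exact: ltW.
      rewrite prim.unlock; apply: le_trans (integral_itv_le _ _ true s0) _ => //=.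
        by move=> _; rewrite lee_fin ltW.
      by rewrite subr0 -EFinM lee_fin ler_piMr// ltW.
    apply/ltW; apply: (lt_le_trans ch1); apply: ge0_subset_integral => //.
      by apply: measurable_rearr; exact: measurable_itv.
    by apply: subset_itvl; rewrite bnd_simp.
  have [] // := @bfs_solid _ _ E (chi c) (grid_step (1 / n%:R) (fun _ : 'I_n => c)) (mchi c) Es.
    apply: ae_domW => s [s0 sa]; have [s1|s1] := ltP s 1; last first.
      by rewrite chi0 ?abse0 ?abse_ge0// s0 ltNge s1.
    rewrite chiE// ; have [|i it] := @grid_cell_exists _ _ n h'0 s s0; first by rewrite nn1.
    by rewrite (grid_stepE _ _ it).
  by move=> Ec nc; split => //; exact: le_trans ns.
have [E1 _] := H 1 ltr01.
have n1 : norm (chi 1) <= 0.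
  rewrite leNgt; apply/negP => n1.
  (* Chosen so that [chi c] has norm [norm y + 1]. *)
  pose c := (norm y + 1) / norm (chi 1).
  have c0 : 0 < c by rewrite divr_gt0// ltr_wpDl// bfs_norm_ge0.
  have [Ec nc] := H c c0.
  have chic : chi c = (fun s => c%:E * chi 1%R s)%E.
    apply/funext => s; have [/andP[s0 s1]|ns] := pselect (0 <= s < 1).
      by rewrite !chiE// mule1.
    by rewrite !chi0// mule0.
  move: nc; rewrite chic bfs_norm_scale// gtr0_norm// divfK ?gt_eqF//.
  by rewrite gerDl ler10.
have /eqP n1' : norm (chi 1) == 0 by rewrite eq_le n1 bfs_norm_ge0.
have [N [mN N0 NH]] := bfs_norm_eq0 E1 n1'.
have : (1 <= mu N)%E.
  have /esym := @lebesgue_measure_itv_le R 0 1 true true ler01; rewrite subr0 => ->.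
  apply: (le_measure mu); rewrite ?inE//.
  move=> s/=; rewrite in_itv/= => /andP[s0 s1]; apply: NH => /=.
  move=> /(_ (conj s0 _)); rewrite chiE// => H1.
  have /H1 [] : (s%:E < alpha)%E by apply: lt_le_trans alpha1; rewrite lte_fin.
  by move/eqP; rewrite oner_eq0.
by rewrite [X in (_ <= X)%E]N0 lee_fin ler10.
Qed.

Lemma submajP x y : submaj alpha x y <-> forall t, 0 < t -> (prim (rr x) t <= prim (rr y) t)%E.
Proof.
by rewrite prim.unlock; split=> H t t0; have := H t t0; rewrite /max_rearr lee_pmul2l// lte_fin invr_gt0.
Qed.

Lemma submaj_trans x y z : submaj alpha x y -> submaj alpha y z -> submaj alpha x z.
Proof. by move=> xy yz t t0; apply: le_trans (xy t t0) (yz t t0). Qed.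

Lemma rearr_fin_submaj x y t : mem y -> submaj alpha x y -> 0 < t -> rr x t \is a fin_num.
Proof.
move=> Ey /submajP xy t0; rewrite ge0_fin_numE ?rearr_ge0//.
have := prim_ge_mul (@rearr_antitone _ alpha x) (@rearr_ge0 _ alpha x) (ltW t0).
move=> /le_trans/(_ (xy t t0)) /le_lt_trans/(_ (prim_rearr_lty t Ey)).
by case: (rr x t) (@rearr_ge0 _ alpha x t) => [r| |]//; rewrite ?ltry// gt0_mulye ?lte_fin.
Qed.

(** Three changes to x* make room for discretization. Truncation at x*(tau) keeps it below y* near
    0, the factor [1 - e] absorbs the integral of y* over a short initial interval, and the shift by
    [eta], at least the mesh, compensates for sampling at right endpoints. *)
Lemma submaj_approx x y (e tau eta T : R) : mem y -> submaj alpha x y ->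
  0 < e < 1 -> 0 < tau -> 0 < eta -> 0 < T -> (T%:E <= alpha)%E ->
  exists f, [/\ mem f, norm f <= norm y, (forall t, 0 <= f t)%E &
    forall t, 0 <= t -> t < T ->
    ((1 - e)%:E * mine (rr x (t + eta)%R) (rr x tau) <= f t)%E].
Proof.
move=> Ey xy /andP[e0 e1] tau0 eta0 T0 Ta.
have xfin t : 0 < t -> rr x t \is a fin_num by exact: rearr_fin_submaj xy.
have /submajP xyp := xy.
have xanti := @rearr_antitone _ alpha x; have xge0 := @rearr_ge0 _ alpha x.
have yanti := @rearr_antitone _ alpha y; have yge0 := @rearr_ge0 _ alpha y.
pose c := fine (rr x tau).
have cE : rr x tau = c%:E by rewrite fineK// xfin.
have c_ge0 : 0 <= c by rewrite fine_ge0.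
have minfin t : mine (rr x t) (rr x tau) \is a fin_num.
  rewrite cE ge0_fin_numE ?le_min ?xge0 ?lee_fin//.
  by rewrite gt_min ltry orbT.
have [c0|cn0] := ltP 0 c; last first.
  have c00 : c = 0 by apply/eqP; rewrite eq_le cn0.
  exists (fun t => 0%:E * y t)%E; split.
  - exact: bfs_scale.
  - by rewrite bfs_norm_scale// normr0 mul0r bfs_norm_ge0.
  - by move=> t; rewrite mul0e.
  - move=> t t0 tT; rewrite mul0e cE c00.
    by rewrite min_r ?xge0// mule0.
pose g t := (1 - e) * fine (mine (rr x t) (rr x tau)).
have gE t : (g t)%:E = ((1 - e)%:E * mine (rr x t) (rr x tau))%E.
  by rewrite /g EFinM fineK.
have e10 : 0 < 1 - e by rewrite subr_gt0.
have g0 t : 0 <= g t.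
  by rewrite mulr_ge0 ?(ltW e10)// fine_ge0// le_min !xge0.
have ganti s t : s <= t -> g t <= g s.
  move=> st; rewrite -lee_fin !gE lee_wpmul2l ?lee_fin ?(ltW e10)//.
  by rewrite le_min !ge_min lexx xanti//= orbT.
have gc s : g s <= (1 - e) * c.
  by rewrite -lee_fin gE EFinM -cE lee_wpmul2l ?lee_fin ?(ltW e10)// ge_min lexx orbT.
(* As [c * tau] is at most the primitive of x* at [tau], hence that of y*, some integral of y* over
   []d, tau]] exceeds [(1 - e) * c * tau]. This forces y* at [d] above the maximum [(1 - e) * c] of
   [g]. *)
have [d /andP[d0 dtau] cd] : exists2 d, 0 < d < tau &
    (((1 - e) * c * tau)%:E < \int[mu]_(u in `]d, tau]) rr y u)%E.
  apply: prim_approx => //; apply: lt_le_trans (xyp _ tau0).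
  apply: lt_le_trans (prim_ge_mul xanti xge0 (ltW tau0)).
  by rewrite cE -EFinM lte_fin ltr_pM2r// gtr_pMl// gtrBl.
have gd s : ((g s)%:E <= rr y d)%E.
  apply: (@le_trans _ _ ((1 - e) * c)%:E); first by rewrite lee_fin.
  move: cd => /lt_le_trans/(_ (integral_itv_le yanti yge0 false (ltW dtau))).
  rewrite -(fineK (rearr_fin Ey d0)) -EFinM lte_fin lee_fin => H.
  rewrite leNgt; apply/negP => H2.
  have yd0 : 0 <= fine (rr y d) by rewrite fine_ge0.
  by nra.
pose m t := mine (rr x t) (rr x tau).
have m_anti s t : s <= t -> (m t <= m s)%E.
  by move=> st; rewrite le_min !ge_min lexx xanti//= orbT.
have m_ge0 t : (0 <= m t)%E by rewrite le_min !xge0.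
have primg t : prim (EFin \o g) t = ((1 - e)%:E * prim m t)%E.
  rewrite prim.unlock -ge0_integralZl_EFin//; last by rewrite (ltW e10).
    by apply: eq_integral => u _; rewrite /= gE.
  by apply: (measurable_funS measurableT) => //; exact: measurable_antitone.
(* The primitive of [m] is at least [c * d] from [d] on, so a loss of [e * (c * d)] on [0, h1] is
   absorbed. *)
have cd0 : 0 < e * (c * d) by rewrite !mulr_gt0.
have [h1 /andP[h10 h1d] yh1] := prim_small yanti yge0 d0 (prim_rearr_lty d Ey) cd0.
have [n n0] : exists2 n : nat, (0 < n)%N & T / n%:R <= Num.min h1 eta.
  by apply: exists_fraction_le; rewrite // lt_min h10.
rewrite le_min => /andP[nh1 neta].
have h0 : 0 < T / n%:R by rewrite divr_gt0// ltr0n.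
have nT : n%:R * (T / n%:R) = T by rewrite mulrC divfK// pnatr_eq0 -lt0n.
exists (grid_step (T / n%:R) (fun i : 'I_n => g (i.+1%:R * (T / n%:R)))).
have [| | |Ef nf] := @grid_step_le_rearr y g (T / n%:R) n d h1 Ey h0 _ ganti g0 nh1 h1d _ _.
- by rewrite nT.
- by move=> s _; exact: gd.
- rewrite nT => t dt tT.
  have t0 : 0 < t by exact: lt_le_trans dt.
  have pm : (prim m t <= prim (rr x) t)%E.
    rewrite prim.unlock; apply: ge0_le_integral => //.
    + apply: (measurable_funS measurableT) => //; exact: measurable_antitone.
    + by apply: measurable_rearr; exact: measurable_itv.
    + by move=> u _; rewrite ge_min lexx.
  have pxfin : (prim m t < +oo)%E.
    by apply: le_lt_trans pm _; apply: le_lt_trans (xyp _ t0) _; exact: prim_rearr_lty.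
  have pfin : prim m t \is a fin_num by rewrite ge0_fin_numE ?prim_ge0.
  have cdm : ((c * d)%:E <= prim m t)%E.
    apply: le_trans (prim_le m_anti m_ge0 dt).
    apply: le_trans (prim_ge_mul m_anti m_ge0 (ltW d0)).
    rewrite EFinM lee_wpmul2r// ?lee_fin ?(ltW d0)// le_min -cE lexx andbT.
    by apply: xanti; exact: ltW.
  have h1t : h1 <= t by rewrite (le_trans _ dt)// ltW.
  have := le_trans pm (xyp _ t0); rewrite (prim_split yanti yge0 (ltW h10) h1t).
  rewrite primg; move=> H; have I0 := @integral_ge0 _ _ _ mu `]h1, t]%classic _ (fun u _ => yge0 u).
  exact: (lee_absorb e0 (prim_ge0 yge0 h1) I0 yh1 cdm pfin H).
split => //; first by move=> t; exact: grid_step_ge0.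
move=> t t0 tT; have [|i it] := @grid_cell_exists _ _ n h0 t t0; first by rewrite nT.
rewrite (grid_stepE _ _ it)// -gE lee_fin; apply: ganti.
move: it; rewrite /grid_cell/= in_itv/= => /andP[it _].
by rewrite -addn1 natrD mulrDl mul1r lerD.
Qed.

(** With [e], [tau] and [eta] tending to 0 and [T] exhausting the domain, right continuity of x*
    shows that the lower limit of the approximants is at least x*, and [bfs_fatou] applies. *)
Theorem K_monotone x y : L0 alpha x -> mem y -> submaj alpha x y ->
  mem x /\ norm x <= norm y.
Proof.
move=> mx Ey xy.
pose e (m : nat) : R := m.+2%:R^-1.
have e0 m : 0 < e m by rewrite invr_gt0.
have e1 m : e m < 1 by rewrite invf_lt1// ltr1n.
pose T (m : nat) : R := if alpha == +oo%E then m.+1%:R else fine alpha.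
have T0 m : 0 < T m.
  rewrite /T; case: eqP => // /eqP ay; rewrite fine_gt0// (lt_le_trans _ alpha1)//=.
  by rewrite ltey.
have Ta m : ((T m)%:E <= alpha)%E.
  rewrite /T; case: eqP => [->|/eqP ay]; first by rewrite leey.
  by rewrite fineK// ge0_fin_numE// ltey.
have e01 m : 0 < e m < 1 by rewrite e0 e1.
have [f Hf] := choice (fun m => submaj_approx Ey xy (e01 m) (e0 m) (e0 m) (T0 m) (Ta m)).
have [Ex nx] : mem (rr x) /\ norm (rr x) <= norm y.
  apply: (@bfs_fatou _ _ E Efatou f) => //.
  - by move=> n; case: (Hf n).
  - by move=> n t _; case: (Hf n).
  - by move=> n; case: (Hf n).
  - exact: L0_rearr.
  - by move=> t _; exact: rearr_ge0.
  apply: ae_dom_gt0 => t dt t0; rewrite leNgt; apply/negP => H.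
  have L0' : (0 <= limn_einf (f ^~ t))%E.
    by apply: (@limn_einf_ge _ _ _ 0%N) => m _; case: (Hf m).
  have [q [q0 qL qx]] := ge0_le_fin_lt L0' H.
  have [q' [qq' q'x]] := lte_fin_between qx.
  have [d d0 q'd] := rearr_rcont mx q'x.
  rewrite lte_fin in qq'; have q'0 : 0 < q' by exact: le_lt_trans qq'.
  (* The level [q'] is exceeded by x* slightly to the right of [t]; the gap between [q''] and [q']
     absorbs the factor [1 - e m]. *)
  have [q'' [/= qq'' q''q']] : exists q'' : R, q < q'' /\ q'' < q'.
    by exists ((q + q') / 2); split; lra.
  have [N1 N1P] := ltr_add_invr (d0 : 0 < d); rewrite add0r in N1P.
  have qq0 : 0 < (q' - q'') / q' by rewrite divr_gt0// subr_gt0.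
  have [N3 N3P] := ltr_add_invr qq0; rewrite add0r in N3P.
  have [N4 N4P] : exists N4, forall m, (N4 <= m)%N -> t < T m.
    case: dt => _ ta; rewrite /T; case: eqP => [ay|/eqP ay]; last first.
      by exists 0%N => m _; rewrite -lte_fin fineK// ge0_fin_numE// ltey.
    have := archi_boundP (ltW t0); set N := Num.bound _ => tN.
    by exists N => m Nm; apply: (lt_le_trans tN); rewrite ler_nat (leq_trans Nm).
  have : (q''%:E <= limn_einf (f ^~ t))%E.
    apply: (@limn_einf_ge _ _ _ (N1 + N3 + N4)%N) => m /= Nm.
    have eS N : (N <= m)%N -> e m <= N.+1%:R^-1.
      by move=> Nm'; rewrite lef_pV2 ?posrE// ler_nat ltnS leqW.
    have N1m : (N1 <= m)%N by apply: leq_trans Nm; rewrite -!addnA leq_addr.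
    have N3m : (N3 <= m)%N by apply: leq_trans Nm; rewrite addnAC leq_addl.
    have N4m : (N4 <= m)%N by apply: leq_trans Nm; rewrite leq_addl.
    case: (Hf m) => _ _ _ /(_ t (ltW t0) (N4P _ N4m)); apply: le_trans.
    have -> : mine (rr x (t + e m)%R) (rr x (e m)) = rr x (t + e m).
      apply: min_l; apply: rearr_antitone; have := e0 m; lra.
    have q'm : (q'%:E <= rr x (t + e m))%E.
      apply: (le_trans (ltW q'd)); apply: rearr_antitone; rewrite lerD2l.
      by apply: le_trans (ltW N1P); exact: eS.
    apply: (@le_trans _ _ ((1 - e m)%:E * q'%:E)%E); last first.
      by rewrite lee_wpmul2l// lee_fin subr_ge0 ltW.
    rewrite -EFinM lee_fin.
    have : e m * q' <= q' - q''.
      by rewrite -ler_pdivlMr//; apply: le_trans (ltW N3P); exact: eS.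
    by lra.
  by move=> /le_trans/(_ qL); rewrite lee_fin leNgt qq''.
have Ex' := bfs_rearr_mem Esym mx Ex; split => //.
by rewrite -(bfs_rearr Esym Ex').2.
Qed.

End K_monotone.

(** * From decreasing uniform K-monotonicity to K-order continuity *)

Section clipped_primitive.
Context (R : realType) (alpha : \bar R).
Hypothesis alpha1 : (1 <= alpha)%E.
Local Notation mu := (@lebesgue_measure R).
Local Notation rr := (rearr alpha).

Lemma eq_prim_lt (f g : R -> \bar R) (t : R) :
  measurable_fun setT f -> measurable_fun setT g ->
  (forall s, 0 <= s -> s < t -> f s = g s) -> prim f t = prim g t.
Proof.
move=> mf mg fg; rewrite prim.unlock -integral_itv_bndo_bndc; last exact: measurable_funS mf.
rewrite -integral_itv_bndo_bndc; last exact: measurable_funS mg.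
by apply: eq_integral => s; rewrite inE/= in_itv/= => /andP[s0 st]; exact: fg.
Qed.

(* The rearrangement over [0, alpha) vanishes from alpha on, so a comparison of
   primitives only has to be made at points t <= alpha. *)
Lemma prim_rearr_clip (t : R) : 0 < t -> exists2 t', 0 < t' &
  forall f : R -> \bar R,
  (forall s t, s <= t -> (f t <= f s)%E) -> (forall s, 0 <= f s)%E ->
  (forall t (q : \bar R), (q < f t)%E -> exists2 e : R, 0 < e & (q < f (t + e)%R)%E) ->
  prim (rr f) t = prim f t'.
Proof.
move=> t0; have a0 : (0 <= alpha)%E by apply: le_trans alpha1.
have H t' (f : R -> \bar R) : (t'%:E <= alpha)%E ->
    (forall s t, s <= t -> (f t <= f s)%E) -> (forall s, 0 <= f s)%E ->
    (forall t (q : \bar R), (q < f t)%E -> exists2 e : R, 0 < e & (q < f (t + e)%R)%E) ->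
    prim (rr f) t' = prim f t'.
  move=> ta af f0 rc; apply: eq_prim_lt.
  - exact: measurable_rearr.
  - exact: measurable_antitone.
  - move=> s s0 st; apply: rearr_antitone_id => //; first exact: rc.
    by split => //; apply: lt_le_trans ta; rewrite lte_fin.
have [ta|at'] := leP t%:E alpha.
  by exists t => // f *; exact: H.
have af : alpha \is a fin_num by rewrite ge0_fin_numE// (lt_trans at')// ltry.
have fa0 : 0 < fine alpha by rewrite fine_gt0// (lt_le_trans _ alpha1)//= ltey_eq af.
exists (fine alpha) => // f anf f0 rc.
have fa : ((fine alpha)%:E <= alpha)%E by rewrite fineK.
rewrite -(H _ _ fa anf f0 rc).
have mf : L0 alpha f.
  apply: (measurable_funS measurableT) => //; exact: measurable_antitone.
rewrite (@prim_split _ (rr f) _ _ (fine alpha))//; first last.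
- by rewrite -lee_fin fineK// ltW.
- exact: ltW.
- by move=> s; exact: rearr_ge0.
- by move=> *; exact: rearr_antitone.
rewrite [X in (_ + X)%E]integral0_eq ?adde0// => s/=; rewrite in_itv/= => /andP[as' _].
rewrite rearr_notin_dom//; first by apply/ltW; exact: lt_trans as'.
by case=> _; rewrite -(fineK af) lte_fin ltNge (ltW as').
Qed.

End clipped_primitive.

(** * Chords of concave primitives *)

HB.lock Definition rprim (R : realType) (f : R -> \bar R) (t : R) : R := fine (prim f t).

Section averaged.
Context (R : realType) (f : R -> \bar R).
Hypothesis f_anti : forall s t, s <= t -> (f t <= f s)%E.
Hypothesis f_ge0 : forall t, (0 <= f t)%E.
Hypothesis f_rc : forall t (q : \bar R), (q < f t)%E ->
  exists2 e : R, 0 < e & (q < f (t + e)%R)%E.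
Hypothesis f_int : forall t, (prim f t < +oo)%E.
Local Notation mu := (@lebesgue_measure R).
Local Notation F := (rprim f).

Definition chord (d T : R) : R := (F T - F d) / (T - d).

(* The conditional expectation of f with respect to the partition of the half
   line into the cell [d, T) and points; its primitive replaces that of f by its
   chord over [d, T]. *)
Definition averaged (d T t : R) : \bar R :=
  if (t < d) || (T <= t) then f t else (chord d T)%:E.

Lemma rprimE t : prim f t = (F t)%:E.
Proof. by rewrite rprim.unlock fineK// ge0_fin_numE// prim_ge0. Qed.

Lemma antitone_fin t : 0 < t -> f t = (fine (f t))%:E.
Proof.
move=> t0; rewrite fineK// ge0_fin_numE//.
have := le_lt_trans (prim_ge_mul f_anti f_ge0 (ltW t0)) (f_int t).
by case: (f t) (f_ge0 t) => [r| |]//; rewrite ?ltry// gt0_mulye ?lte_fin.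
Qed.

Lemma rprim_ge0 t : 0 <= F t.
Proof. by rewrite rprim.unlock fine_ge0// prim_ge0. Qed.

Lemma rprim_le s t : s <= t -> F s <= F t.
Proof. by move=> st; rewrite -lee_fin -!rprimE prim_le. Qed.

Lemma rprim_incr_le s t : 0 < s -> s <= t -> F t - F s <= fine (f s) * (t - s).
Proof.
move=> s0 st; rewrite lerBlDl -lee_fin EFinD EFinM -!rprimE -antitone_fin//.
by rewrite prim_le_add// ltW.
Qed.

Lemma rprim_incr_ge s t : 0 < s -> s <= t -> fine (f t) * (t - s) <= F t - F s.
Proof.
move=> s0 st; have t0 : 0 < t by exact: lt_le_trans st.
rewrite lerBrDl -lee_fin EFinD EFinM -!rprimE -antitone_fin//.
by rewrite prim_ge_add// ltW.
Qed.

Lemma rprim_ge_mul t : 0 < t -> fine (f t) * t <= F t.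
Proof.
move=> t0; rewrite -lee_fin EFinM -rprimE -antitone_fin//.
by rewrite prim_ge_mul// ltW.
Qed.

Section fixed_cell.
Variables (d T : R).
Hypotheses (d0 : 0 < d) (dT : d < T).
Let m := chord d T.

Let mE : m * (T - d) = F T - F d.
Proof. by rewrite /m /chord divfK// subr_eq0 gt_eqF. Qed.

Lemma chord_ge0 : 0 <= chord d T.
Proof. by rewrite divr_ge0// subr_ge0 ?rprim_le// ltW. Qed.

Lemma chord_le : ((chord d T)%:E <= f d)%E.
Proof.
rewrite antitone_fin// lee_fin ler_pdivrMr ?subr_gt0//.
by apply: rprim_incr_le => //; exact: ltW.
Qed.

Lemma chord_ge : (f T <= (chord d T)%:E)%E.
Proof.
rewrite antitone_fin ?(lt_trans d0)// lee_fin ler_pdivlMr ?subr_gt0//.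
by apply: rprim_incr_ge => //; exact: ltW.
Qed.

Lemma averaged_ge0 t : (0 <= averaged d T t)%E.
Proof. by rewrite /averaged; case: ifP => // _; rewrite lee_fin chord_ge0. Qed.

Lemma averaged_anti s t : s <= t -> (averaged d T t <= averaged d T s)%E.
Proof.
move=> st; rewrite /averaged.
have [td/=|dt] := ltP t d.
  by rewrite (le_lt_trans st td)/= f_anti.
have [Tt/=|tT] := leP T t.
  have [sd/=|ds] := ltP s d; first exact: f_anti.
  have [Ts/=|sT/=] := leP T s; first exact: f_anti.
  by apply: le_trans chord_ge; exact: f_anti.
rewrite /= (leNgt T s) (le_lt_trans st tT)/= orbF.
have [sd|ds //] := ltP s d.
by apply: (le_trans chord_le); apply: f_anti; exact: ltW.
Qed.

Lemma averaged_rc t (q : \bar R) : (q < averaged d T t)%E ->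
  exists2 e : R, 0 < e & (q < averaged d T (t + e)%R)%E.
Proof.
rewrite {1}/averaged; have [td/= qt|dt] := ltP t d.
  have [e e0 qe] := f_rc qt; exists (Num.min e ((d - t) / 2)).
    by rewrite lt_min e0 divr_gt0// subr_gt0.
  rewrite /averaged (_ : _ < d)/=.
    by apply: (lt_le_trans qe); apply: f_anti; rewrite lerD2l ge_min lexx.
  have : Num.min e ((d - t) / 2) <= (d - t) / 2 by rewrite ge_min lexx orbT.
  by lra.
have [Tt/= qt|tT/= qm] := leP T t.
  have [e e0 qe] := f_rc qt; exists e => //.
  by rewrite /averaged (_ : T <= t + e) ?orbT//; lra.
exists ((T - t) / 2); first by rewrite divr_gt0// subr_gt0.
have -> : averaged d T (t + (T - t) / 2) = (chord d T)%:E; last by [].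
rewrite /averaged; case: ltP => [?|_]; first by exfalso; lra.
by case: leP => //= ?; exfalso; lra.
Qed.

Lemma prim_averaged_l t : t <= d -> prim (averaged d T) t = (F t)%:E.
Proof.
move=> td; rewrite -rprimE; apply: eq_prim_lt.
- by apply: measurable_antitone; exact: averaged_anti.
- exact: measurable_antitone.
- by move=> s s0 st; rewrite /averaged (lt_le_trans st).
Qed.

Lemma prim_averaged_m t : d <= t -> t <= T ->
  prim (averaged d T) t = (F d + m * (t - d))%:E.
Proof.
move=> dt tT; rewrite (prim_split averaged_anti averaged_ge0 (ltW d0) dt).
rewrite prim_averaged_l// EFinD; congr (_ + _)%E.
rewrite -integral_itv_bndo_bndc; last first.
  apply: (measurable_funS measurableT) => //.
  by apply: measurable_antitone; exact: averaged_anti.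
rewrite EFinM -(@lebesgue_measure_itv_le _ _ _ false true dt) -integral_cst//.
apply: eq_integral => s; rewrite inE/= in_itv/= => /andP[ds st].
by rewrite /averaged ltNge (ltW ds)/= leNgt (lt_le_trans st).
Qed.

Lemma prim_averaged_r t : T <= t -> prim (averaged d T) t = (F t)%:E.
Proof.
move=> Tt; have T0 : 0 < T by exact: lt_trans dT.
rewrite (prim_split averaged_anti averaged_ge0 (ltW T0) Tt).
have -> : prim (averaged d T) T = (F T)%:E.
  by rewrite prim_averaged_m ?(ltW dT)// mE addrC subrK.
rewrite -!rprimE.
rewrite (prim_split f_anti f_ge0 (ltW T0) Tt); congr (_ + _)%E.
apply: eq_integral => s; rewrite inE/= in_itv/= => /andP[Ts st].
by rewrite /averaged (ltW Ts) orbT.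
Qed.

(** A chord lies below a concave function: the value of [f] at [t] is a supergradient of [F] there,
    and the inequalities towards [d] and [T] are combined with weights [T - t] and [t - d]. *)
Lemma prim_averaged_le t : (prim (averaged d T) t <= prim f t)%E.
Proof.
rewrite rprimE; have [td|dt] := leP t d; first by rewrite prim_averaged_l.
have [tT|Tt] := leP t T; last by rewrite prim_averaged_r// ltW.
rewrite prim_averaged_m ?(ltW dt)// lee_fin.
have t0 : 0 < t by exact: lt_trans dt.
have H1 := rprim_incr_ge d0 (ltW dt); have H2 := rprim_incr_le t0 tT.
have TdP : 0 < T - d by rewrite subr_gt0.
rewrite -(ler_pM2r TdP).
have : m * (t - d) * (T - d) = (F T - F d) * (t - d) by rewrite -mE; ring.
move: H1 H2; set a := fine (f t) => H1 H2 E.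
have K1 : (F T - F t) * (t - d) <= a * (T - t) * (t - d).
  by rewrite ler_pM2r// subr_gt0.
have K2 : a * (t - d) * (T - t) <= (F t - F d) * (T - t).
  by rewrite ler_wpM2r// subr_ge0.
by rewrite mulrDl E; lra.
Qed.

Lemma prim_averaged_ge t : d <= t -> ((F d)%:E <= prim (averaged d T) t)%E.
Proof.
move=> dt; have [tT|Tt] := leP t T.
  by rewrite prim_averaged_m// lee_fin lerDl mulr_ge0 ?chord_ge0// subr_ge0.
by rewrite prim_averaged_r ?(ltW Tt)// lee_fin rprim_le.
Qed.

End fixed_cell.

(** The longer chord is below [F] at [d] and [T] and affine between, so it stays below the shorter
    chord. Off [d, T] the right-hand side is [F] itself. *)
Lemma prim_averaged_anti d T d' T' t : 0 < d' -> d' <= d -> d < T -> T <= T' ->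
  (prim (averaged d' T') t <= prim (averaged d T) t)%E.
Proof.
move=> d'0 d'd dT TT'.
have d0 : 0 < d by exact: lt_le_trans d'd.
have d'T' : d' < T' by exact: le_lt_trans (lt_le_trans dT TT').
have [td|dt] := leP t d.
  by rewrite [leRHS]prim_averaged_l// -rprimE prim_averaged_le.
have [tT|Tt] := leP t T; last first.
  by rewrite [leRHS](prim_averaged_r _ _ (ltW Tt))// -rprimE prim_averaged_le.
have := prim_averaged_le d'0 d'T' d; have := prim_averaged_le d'0 d'T' T.
have [d't d'T tT' dT' dt'] : [/\ d' <= t, d' <= T, t <= T', d <= T' & d <= t].
  by split; lra.
rewrite !rprimE !prim_averaged_m//.
rewrite !lee_fin; set p := chord d' T'; set m := chord d T => H1 H2.
have mE : m * (T - d) = F T - F d.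
  by rewrite /m /chord divfK// subr_eq0 gt_eqF.
have TdP : 0 < T - d by rewrite subr_gt0.
rewrite -(ler_pM2r TdP).
have K1 : (F d' + p * (d - d')) * (T - t) <= F d * (T - t).
  by rewrite ler_wpM2r// subr_ge0.
have K2 : (F d' + p * (T - d')) * (t - d) <= F T * (t - d).
  by rewrite ler_wpM2r// subr_ge0 ltW.
have E : (F d + m * (t - d)) * (T - d) = F d * (T - d) + (F T - F d) * (t - d).
  by rewrite -mE; ring.
by rewrite E; lra.
Qed.

End averaged.

Section decreasing_uniform_to_order_continuous.
Context (R : realType) (alpha : \bar R) (E : banachFunctionSpace alpha).
Hypothesis Esym : symmetric_space E.
Hypothesis Efatou : fatou_property E.
Hypothesis alpha1 : (1 <= alpha)%E.
Implicit Types x y : R -> \bar R.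
Local Notation mem := (bfs_mem E).
Local Notation norm := (bfs_norm E).
Local Notation mu := (@lebesgue_measure R).
Local Notation rr := (rearr alpha).

Let alpha0 : (0 <= alpha)%E.
Proof. by apply: le_trans alpha1. Qed.

(** On the half line, x* >= e everywhere would put every indicator of (0, t) below x*/e and bound
    the fundamental function by |x|/e. On [0, 1) the rearrangement is 0 at 1. *)
Lemma rearr_vanishes x (e : R) :
  (alpha = 1%E \/ alpha = +oo%E) ->
  (alpha = +oo%E -> fundamental_fun E t @[t --> +oo%R] --> +oo%R) ->
  mem x -> 0 < e -> exists2 T, 0 < T & (rr x T <= e%:E)%E.
Proof.
move=> [a1 _|ay Ephi] Ex e0.
  exists 1 => //; rewrite rearr_notin_dom// ?lee_fin ?(ltW e0)//; first exact: bfs_L0 Ex.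
  by case=> _; rewrite a1 lte_fin ltxx.
apply: contrapT => H.
have ge t : (e%:E <= rr x t)%E.
  apply: (@le_trans _ _ (rr x (Num.max t 1))).
    rewrite leNgt; apply/negP => /ltW ?; apply: H; exists (Num.max t 1) => //.
    by rewrite lt_max ltr01 orbT.
  by apply: rearr_antitone; rewrite le_max lexx.
have [Erx nrx] := bfs_rearr Esym Ex.
have Es := bfs_scale e^-1 Erx.
have /cvgryPgt/(_ (e^-1 * norm x)) [M [_ HM]] := Ephi ay.
have /HM : M < M + 1 by rewrite ltrDl.
rewrite /fundamental_fun ltNge => /negP; apply.
rewrite -nrx -[in leRHS](@ger0_norm _ e^-1) ?invr_ge0 ?(ltW e0)// -bfs_norm_scale//.
apply: (bfs_solid _ Es _).2.
  apply/measurable_EFinP; apply: measurable_indic; exact: measurable_itv.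
apply: ae_domW => t _.
have h1 : (1 <= e^-1%:E * rr x t)%E.
  apply: (@le_trans _ _ (e^-1%:E * e%:E)%E).
    by rewrite -EFinM mulVf ?gt_eqF.
  by rewrite lee_wpmul2l// lee_fin invr_ge0 ltW.
rewrite [leRHS]gee0_abs; last by apply: le_trans h1.
apply: le_trans h1; rewrite /= lee_fin indicE.
by case: (_ \in _); rewrite ?normr1 ?normr0.
Qed.

Hypothesis rearr_van : forall x (e : R), mem x -> 0 < e ->
  exists2 T, 0 < T & (rr x T <= e%:E)%E.

(** * Averages over growing cells *)

Section averaged_sequence.
Variable x : R -> \bar R.
Hypothesis Ex : mem x.

Let xanti := @rearr_antitone _ alpha x.
Let xge0 := @rearr_ge0 _ alpha x.
Let mx : L0 alpha x. Proof. exact: bfs_L0 Ex. Qed.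
Let xrc t (q : \bar R) : (q < rr x t)%E -> exists2 e : R, 0 < e & (q < rr x (t + e)%R)%E.
Proof. exact: rearr_rcont. Qed.
Let xint t : (prim (rr x) t < +oo)%E. Proof. exact: prim_rearr_lty Ex. Qed.
Local Notation F := (rprim (rr x)).

(** The offset 2 makes the cell nondegenerate and places 1 in its interior already for [n = 0]. *)
Definition avg_seq (n : nat) : R -> \bar R := averaged (rr x) n.+2%:R^-1 n.+2%:R.

Let dn0 n : 0 < n.+2%:R^-1 :> R. Proof. by rewrite invr_gt0. Qed.
Let dnlt1 n : n.+2%:R^-1 < 1 :> R. Proof. by rewrite invf_lt1// ltr1n. Qed.
Let Tn1 n : 1 < n.+2%:R :> R. Proof. by rewrite ltr1n. Qed.
Let dTn n : n.+2%:R^-1 < n.+2%:R :> R. Proof. exact: lt_trans (dnlt1 n) (Tn1 n). Qed.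

Lemma avg_seq_anti n s t : s <= t -> (avg_seq n t <= avg_seq n s)%E.
Proof. exact: averaged_anti. Qed.

Lemma avg_seq_ge0 n t : (0 <= avg_seq n t)%E.
Proof. exact: averaged_ge0. Qed.

Lemma avg_seq_rc n t (q : \bar R) : (q < avg_seq n t)%E ->
  exists2 e : R, 0 < e & (q < avg_seq n (t + e)%R)%E.
Proof. exact: averaged_rc. Qed.

Lemma L0_avg_seq n : L0 alpha (avg_seq n).
Proof.
apply: (measurable_funS measurableT) => //; apply: measurable_antitone.
exact: avg_seq_anti.
Qed.

(** The clipped point given by [prim_rearr_clip] depends on [t] alone, so both primitives are
    compared at the same place. *)
Lemma submaj_prim (u v u' v' : R -> \bar R) :
  rr u = rr u' -> rr v = rr v' ->
  (forall s t, s <= t -> (u' t <= u' s)%E) -> (forall s, 0 <= u' s)%E ->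
  (forall t (q : \bar R), (q < u' t)%E -> exists2 e : R, 0 < e & (q < u' (t + e)%R)%E) ->
  (forall s t, s <= t -> (v' t <= v' s)%E) -> (forall s, 0 <= v' s)%E ->
  (forall t (q : \bar R), (q < v' t)%E -> exists2 e : R, 0 < e & (q < v' (t + e)%R)%E) ->
  (forall t, 0 < t -> (prim u' t <= prim v' t)%E) -> submaj alpha u v.
Proof.
move=> uu' vv' au u0 ru av v0 rv H; apply/submajP => t t0.
have [t' t'0 tt'] := prim_rearr_clip alpha1 t0.
by rewrite uu' vv' !tt'//; exact: H.
Qed.

Lemma avg_seq_submaj_x n : submaj alpha (avg_seq n) x.
Proof.
apply: (@submaj_prim _ _ (avg_seq n) (rr x)) => //.
- by rewrite rearr_rearr.
- exact: avg_seq_anti.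
- exact: avg_seq_ge0.
- exact: avg_seq_rc.
- by move=> t _; exact: prim_averaged_le.
Qed.

Lemma avg_seq_submaj n m : (n <= m)%N -> submaj alpha (avg_seq m) (avg_seq n).
Proof.
move=> nm; apply: (@submaj_prim _ _ (avg_seq m) (avg_seq n)) => //;
  try exact: avg_seq_anti; try exact: avg_seq_ge0; try exact: avg_seq_rc.
move=> t _; apply: prim_averaged_anti => //.
  by rewrite lef_pV2 ?posrE// ler_nat !ltnS.
by rewrite ler_nat !ltnS.
Qed.

Lemma mem_avg_seq n : mem (avg_seq n).
Proof. exact: (K_monotone Esym Efatou alpha1 (L0_avg_seq n) Ex (avg_seq_submaj_x n)).1. Qed.

Lemma norm_avg_seq n m : (n <= m)%N -> norm (avg_seq m) <= norm (avg_seq n).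
Proof.
move=> nm; apply: (K_monotone Esym Efatou alpha1 _ (mem_avg_seq n) _).2.
  exact: L0_avg_seq.
exact: avg_seq_submaj.
Qed.

(** Once [t] is in the cell, the value there is the chord slope. Since [F] has slope at most [e/4]
    beyond [S], the increment of [F] over the cell is at most [e * T / 2] for large [T]. *)
Lemma avg_seq_cvg0 (t e : R) : 0 < t -> 0 < e ->
  exists N, forall n, (N <= n)%N -> (avg_seq n t <= e%:E)%E.
Proof.
move=> t0 e0; have e4 : 0 < e / 4 by rewrite divr_gt0.
have [S S0 xS] := rearr_van Ex e4.
(* Its terms ensure in turn [1/T < t], [t < T], [S < T] and [F S <= e * T / 4]. *)
pose B := t^-1 + t + S + 4 * F S / e + 1.
have FS0 : 0 <= F S by exact: rprim_ge0.
have B0 : 0 <= 4 * F S / e by rewrite divr_ge0 ?mulr_ge0// ltW.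
have ti0 : 0 < t^-1 by rewrite invr_gt0.
exists (Num.bound B) => n Bn.
have /archi_boundP BB : 0 <= B by rewrite /B; lra.
set T : R := n.+2%:R.
have BT : B < T.
  by apply: (lt_le_trans BB); rewrite ler_nat (leq_trans Bn)// -addn2 leq_addr.
have dt : T^-1 < t.
  rewrite invf_plt ?posrE//; apply: le_lt_trans BT; rewrite /B; lra.
have tT : t < T by apply: le_lt_trans BT; rewrite /B; lra.
have ST : S < T by apply: le_lt_trans BT; rewrite /B; lra.
have FST : 4 * F S <= e * T.
  have : 4 * F S / e <= T by apply: le_trans (ltW BT); rewrite /B; lra.
  by rewrite ler_pdivrMr// (mulrC T).
rewrite /avg_seq /averaged -/T (ltNge t) (ltW dt) [T <= t]leNgt tT/= lee_fin.
have T2 : 2 <= T by rewrite ler_nat.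
have d1 : T^-1 < 1 by exact: dnlt1.
clearbody T; rewrite /chord ler_pdivrMr; last lra.
have H1 := rprim_incr_le xanti xge0 xint S0 (ltW ST).
have xSe : fine (rr x S) <= e / 4.
  by rewrite -lee_fin -(antitone_fin xanti xge0 xint).
have Fd : 0 <= F T^-1 by exact: rprim_ge0.
have H2 : fine (rr x S) * (T - S) <= e / 4 * T.
  apply: ler_pM; rewrite ?fine_ge0 ?subr_ge0 ?(ltW ST)// gerBl; exact: ltW.
have H3 : 0 <= e * (T / 2 - T^-1) by rewrite mulr_ge0 ?(ltW e0)//; lra.
rewrite mulrBr in H3; rewrite mulrBr; lra.
Qed.

(** Rearrangements decrease, so convergence at a single point to the left of [t] suffices, and
    almost everywhere convergence supplies one. *)
Lemma rearr_cvg0_gt0 (u : nat -> R -> \bar R) :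
  (forall k, L0 alpha (u k)) ->
  ae_dom alpha (fun t => rr (u k) t @[k --> \oo] --> 0%E) ->
  forall t e : R, 0 < t -> 0 < e ->
  exists K, forall k, (K <= k)%N -> (rr (u k) t <= e%:E)%E.
Proof.
move=> mu' u0 t e t0 e0.
have [dt|ndt] := pselect (dom alpha t); last first.
  exists 0%N => k _; rewrite rearr_notin_dom ?lee_fin ?(ltW e0)//; exact: ltW.
have [s [s0 st us]] := ae_dom_exists u0 dt t0.
have [K _ HK] : \forall k \near \oo, (rr (u k) s < e%:E)%E.
  have : nbhs (0%E : \bar R) [set y | (y < e%:E)%E].
    by apply: open_nbhs_nbhs; split; [exact: open_ereal_lt_ereal|rewrite /= lte_fin].
  by move=> /us.
exists K => k Kk; apply: (le_trans _ (ltW (HK k Kk))).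
by apply: rearr_antitone; exact: ltW.
Qed.

(** Outside the cell the primitive of [avg_seq n] is [F], and inside it is at least [F d]. It is
    therefore enough that the primitive of u_k* at [T] eventually drops to [F d]. *)
Lemma submaj_avg_seq (u : nat -> R -> \bar R) n :
  (forall k, mem (u k)) -> (forall k, submaj alpha (u k) x) ->
  ae_dom alpha (fun t => rr (u k) t @[k --> \oo] --> 0%E) ->
  exists K, forall k, (K <= k)%N -> submaj alpha (u k) (avg_seq n).
Proof.
move=> Eu ux u0; set d : R := n.+2%:R^-1; set T : R := n.+2%:R.
have d0 : 0 < d by exact: dn0.
have dT : d < T by exact: dTn.
have T0 : 0 < T by exact: lt_trans dT.
have uxp k t : 0 < t -> (prim (rr (u k)) t <= prim (rr x) t)%E.
  by move=> t0; have /submajP H := ux k; exact: H.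
have [K HK] : exists K, forall k, (K <= k)%N -> (prim (rr (u k)) T <= (F d)%:E)%E.
  have : 0 <= F d by exact: rprim_ge0.
  (* If [F d = 0], then x* vanishes from [d] on and [F T = 0] too. Otherwise half of [F d] bounds
     the integral over [0, h], by comparison with [x], and half the one over [h, T], by smallness of
     u_k* at [h]. *)
  rewrite le_eqVlt => /orP[/eqP Fd0|Fd0].
    exists 0%N => k _; apply: (le_trans (uxp k T T0)); rewrite rprimE// lee_fin.
    have := rprim_incr_le xanti xge0 xint d0 (ltW dT).
    have := rprim_ge_mul xanti xge0 xint d0; rewrite -Fd0 => H1.
    have H2 : 0 <= fine (rr x d) by rewrite fine_ge0.
    have -> : fine (rr x d) = 0.
      by apply/eqP; rewrite eq_le H2 andbT -(pmulr_lle0 _ d0).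
    by rewrite mul0r subr0.
  have Fd2 : 0 < F d / 2 by rewrite divr_gt0.
  have [h /andP[h0 hd] xh] := prim_small xanti xge0 d0 (xint d) Fd2.
  have e0 : 0 < F d / 2 / T by rewrite divr_gt0.
  have [K HK] := rearr_cvg0_gt0 (fun k => bfs_L0 (Eu k)) u0 h0 e0.
  exists K => k /HK uh.
  have hT : h <= T by apply/ltW; exact: lt_trans dT.
  apply: le_trans (prim_le_add (@rearr_antitone _ alpha (u k)) (@rearr_ge0 _ alpha (u k)) (ltW h0) hT) _.
  apply: (@le_trans _ _ ((F d / 2)%:E + (F d / 2 / T)%:E * T%:E)%E).
    apply: leeD; first exact: le_trans (uxp k h h0) xh.
    apply: lee_pmul => //; first exact: rearr_ge0.
      by rewrite lee_fin subr_ge0.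
    by rewrite lee_fin gerBl ltW.
  rewrite -EFinM -EFinD lee_fin divfK ?gt_eqF//; lra.
exists K => k Kk; apply: (@submaj_prim _ _ (rr (u k)) (avg_seq n)) => //.
- by rewrite rearr_rearr//; exact: bfs_L0 (Eu k).
- by move=> s t; exact: rearr_antitone.
- by move=> s; exact: rearr_ge0.
- by move=> t q; apply: rearr_rcont; exact: bfs_L0 (Eu k).
- exact: avg_seq_anti.
- exact: avg_seq_ge0.
- exact: avg_seq_rc.
move=> t t0; have [td|dt] := leP t d.
  rewrite /avg_seq (prim_averaged_l xanti xge0 xint d0 dT td) -(rprimE xge0 xint).
  exact: uxp.
have [tT|Tt] := leP t T.
  apply: (@le_trans _ _ (F d)%:E); last by apply: prim_averaged_ge => //; exact: ltW.
  apply: le_trans (HK k Kk); apply: prim_le => //.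
  - by move=> s r; exact: rearr_antitone.
  - by move=> s; exact: rearr_ge0.
rewrite /avg_seq (prim_averaged_r xanti xge0 xint d0 dT (ltW Tt)) -(rprimE xge0 xint).
exact: uxp.
Qed.

Hypothesis dukm : decreasing_uniformly_K_monotone E.

Lemma norm_avg_seq_cvg0 (e : R) : 0 < e -> exists n, norm (avg_seq n) < e.
Proof.
move=> e0; apply: contrapT => H.
have Ne n : e <= norm (avg_seq n).
  by rewrite leNgt; apply/negP => ?; apply: H; exists n.
pose l := limn (fun n => norm (avg_seq n)).
have nN : {homo (fun n => norm (avg_seq n)) : n m / (n <= m)%N >-> m <= n}.
  by move=> n m; exact: norm_avg_seq.
have cN : cvgn (fun n => norm (avg_seq n)).
  apply: nonincreasing_is_cvgn => //; exists 0 => _ [n _ <-].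
  by apply: bfs_norm_ge0; exact: mem_avg_seq.
have lN n : l <= norm (avg_seq n) by exact: nonincreasing_cvgn_ge.
(* If all later terms were within [e/2] of the [n]-th, their convergence to 0 at each point and
   [bfs_fatou] would give [avg_seq n] norm at most [e/2]. *)
have far n M : exists m, (M <= m)%N /\ e / 2 <= rearr_dist E (avg_seq m) (avg_seq n).
  apply: contrapT => H'.
  have {}H' m : (M <= m)%N -> rearr_dist E (avg_seq m) (avg_seq n) < e / 2.
    by move=> Mm; rewrite ltNge; apply/negP => ?; apply: H'; exists m.
  have Erz k := (bfs_rearr Esym (mem_avg_seq k)).1.
  pose D k t := (rr (avg_seq (k + M)%N) t - rr (avg_seq n) t)%E.
  have ED k : mem (D k) by exact: bfs_mem_sub.
  pose f k t := `|D k t|%E.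
  have mf k : L0 alpha (f k).
    by apply: measurableT_comp (bfs_L0 (ED k)); exact: abse_measurable.
  have Ef k : mem (f k) /\ norm (f k) <= norm (D k).
    by apply: bfs_solid => //; apply: ae_domW => t _; rewrite abse_id.
  have [] : mem (rr (avg_seq n)) /\ norm (rr (avg_seq n)) <= e / 2.
    apply: (@bfs_fatou _ _ E Efatou f) => //.
    - by move=> k; exact: (Ef k).1.
    - by move=> k t _; exact: abse_ge0.
    - by move=> k; apply: le_trans (Ef k).2 _; apply/ltW/H'; rewrite leq_addl.
    - exact: L0_rearr.
    - by move=> t _; exact: rearr_ge0.
    apply: ae_dom_gt0 => t dt t0; apply/lee_addgt0Pr => r r0.
    have [N HN] := avg_seq_cvg0 t0 r0.
    rewrite -leeBlDr//; apply: (@limn_einf_ge _ _ _ N) => k Nk.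
    have zk : (rr (avg_seq (k + M)%N) t <= r%:E)%E.
      apply: le_trans (HN (k + M)%N (leq_trans Nk (leq_addr _ _))).
      apply: rearr_antitone_le; [exact: avg_seq_anti|exact: avg_seq_ge0|exact: ltW].
    have fin k' := rearr_fin Esym alpha1 (mem_avg_seq k') t0.
    rewrite /f /D; move: zk; rewrite -(fineK (fin n)) -(fineK (fin (k + M)%N)).
    rewrite -!EFinB lee_fin /= lee_fin => zk.
    rewrite distrC; apply: le_trans (ler_norm _); lra.
  rewrite (bfs_rearr Esym (mem_avg_seq n)).2 => _ /(le_trans (Ne n)); lra.
have [mm Hmm] := choice (fun p : nat * nat => far p.1 p.2).
(* The maximum makes [ms] nondecreasing with [ms n >= n]: the selected terms still decrease for
   submajorization and lie below [avg_seq n]. *)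
pose ms := fix ms n := if n is k.+1 then mm (k.+1, maxn k.+1 (ms k)) else mm (0, 0)%N.
have msn n : (n <= ms n)%N.
  by case: n => //= n; apply: leq_trans (Hmm _).1; rewrite /= leq_maxl.
have msS n : (ms n <= ms n.+1)%N.
  by apply: leq_trans (Hmm _).1; rewrite /= leq_maxr.
have msd n : e / 2 <= rearr_dist E (avg_seq (ms n)) (avg_seq n).
  by case: n => [|n] /=; exact: (Hmm _).2.
have := @dukm (avg_seq \o ms) avg_seq l.
have cms : norm ((avg_seq \o ms) n) @[n --> \oo] --> l.
  apply: (@squeeze_cvgr _ _ _ _ (fun=> l) (fun n => norm (avg_seq n))) => //.
  - by apply: nearW => n; rewrite lN/=; exact: norm_avg_seq.
  - exact: cvg_cst.
move=> /(_ (fun n => mem_avg_seq (ms n)) mem_avg_seq _ cms cN)/wrap[].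
  by move=> n; split; apply: avg_seq_submaj.
move=> /cvgr0Pnorm_lt/(_ (e / 2)); rewrite divr_gt0// => /(_ isT)[N _ /(_ N (leqnn N))].
by move=> /(le_lt_trans (ler_norm _)); rewrite ltNge msd.
Qed.

End averaged_sequence.

Lemma decreasing_uniform_K_order_continuous :
  decreasing_uniformly_K_monotone E -> K_order_continuous E.
Proof.
move=> dukm x u Ex Eu ux u0; apply/cvgr0Pnorm_lt => e e0.
have [n ne] := norm_avg_seq_cvg0 Ex dukm e0.
have [K HK] := submaj_avg_seq Ex n Eu ux u0.
exists K => // k /= Kk; rewrite ger0_norm ?bfs_norm_ge0//.
apply: le_lt_trans ne.
exact: (K_monotone Esym Efatou alpha1 (bfs_L0 (Eu k)) (mem_avg_seq Ex n) (HK k Kk)).2.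
Qed.

End decreasing_uniform_to_order_continuous.

(** * From K-order continuity to decreasing uniform K-monotonicity *)

Lemma limn_einf_le_ub (R : realType) (u : nat -> \bar R) (c : \bar R) N :
  (forall m, (N <= m)%N -> (u m <= c)%E) -> (limn_einf u <= c)%E.
Proof.
move=> uc; rewrite limn_einf_lim; apply: lime_le; first exact: is_cvg_einfs.
apply: nearW => k; apply: le_trans (uc (maxn k N) (leq_maxr _ _)).
by apply: ereal_inf_lbound; exists (maxn k N) => //=; rewrite leq_maxl.
Qed.

Lemma le_limn_einf (R : realType) (u v : nat -> \bar R) :
  (forall n, (u n <= v n)%E) -> (limn_einf u <= limn_einf v)%E.
Proof.
move=> uv; rewrite !limn_einf_lim; apply: lee_lim; try exact: is_cvg_einfs.
apply: nearW => n; apply: le_ereal_inf_tmp => _ [k nk <-].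
by apply: le_trans (uv k); apply: ereal_inf_lbound; exists k.
Qed.

Lemma cvge_ge0_small (R : realType) (u : nat -> \bar R) :
  (forall n, (0 <= u n)%E) ->
  (forall e : R, 0 < e -> exists N, forall n, (N <= n)%N -> (u n <= e%:E)%E) ->
  u n @[n --> \oo] --> 0%E.
Proof.
move=> u0 ue; have [N HN] := ue 1 ltr01.
apply/fine_cvgP; split.
  exists N => // n /= /HN un; rewrite ge0_fin_numE//.
  by apply: le_lt_trans un _; rewrite ltry.
apply/cvgr0Pnorm_lt => e e0; have e2 : 0 < e / 2 by rewrite divr_gt0.
have [M HM] := ue _ e2; exists (maxn N M) => // n /=; rewrite geq_max => /andP[Nn Mn].
have uf : u n \is a fin_num.
  by rewrite ge0_fin_numE// (le_lt_trans (HN n Nn))// ltry.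
rewrite ger0_norm ?fine_ge0//; have := HM n Mn; rewrite -(fineK uf) lee_fin; lra.
Qed.

(* Distinct points of the set own disjoint intervals ]f t, f t + e[. *)
Lemma countable_jumps (R : realType) (f : R -> \bar R) (A : set R) :
  (forall t, A t -> f t \is a fin_num) ->
  (forall t, A t -> exists2 e : R, 0 < e &
     forall s, A s -> s < t -> (f t + e%:E <= f s)%E) ->
  countable A.
Proof.
move=> fA jA.
have H (t : R) : exists q : rat, A t -> (f t < (ratr q)%:E)%E /\
    forall s, A s -> s < t -> ((ratr q)%:E < f s)%E.
  have [At|nAt] := pselect (A t); last by exists 0.
  have [e e0 je] := jA t At.
  have fte : fine (f t) < fine (f t) + e by rewrite ltrDl.
  have [q] := rat_in_itvoo fte; rewrite in_itv/= => /andP[q1 q2].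
  exists q => _; split; first by rewrite -(fineK (fA t At)) lte_fin.
  move=> s As st; apply: lt_le_trans (je s As st).
  by rewrite -(fineK (fA t At)) -EFinD lte_fin.
have [q Hq] := choice H.
apply/countable_injP; exists (fun t => pickle (q t)) => s t; rewrite !inE => As At.
move=> /(pcan_inj pickleK) qst; have [st|ts|//] := ltgtP s t.
  have := lt_trans ((Hq t At).2 s As st) (Hq s As).1.
  by rewrite qst ltxx.
have := lt_trans ((Hq s As).2 t At ts) (Hq t At).1.
by rewrite qst ltxx.
Qed.

Section order_continuous_to_decreasing_uniform.
Context (R : realType) (alpha : \bar R) (E : banachFunctionSpace alpha).
Hypothesis Esym : symmetric_space E.
Hypothesis Efatou : fatou_property E.
Hypothesis alpha1 : (1 <= alpha)%E.
Local Notation mem := (bfs_mem E).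
Local Notation norm := (bfs_norm E).
Local Notation mu := (@lebesgue_measure R).
Local Notation rr := (rearr alpha).
Hypothesis rearr_van : forall x (e : R), mem x -> 0 < e ->
  exists2 T, 0 < T & (rr x T <= e%:E)%E.

(** * The lower limit of a decreasing sequence *)

Section decreasing_sequence.
Variable x : nat -> R -> \bar R.
Hypothesis Ex : forall n, mem (x n).
Hypothesis xS : forall n, submaj alpha (x n.+1) (x n).

Let a n := rr (x n).
Let a_anti n s t : s <= t -> (a n t <= a n s)%E. Proof. exact: rearr_antitone. Qed.
Let a_ge0 n t : (0 <= a n t)%E. Proof. exact: rearr_ge0. Qed.
Let a_int n t : (prim (a n) t < +oo)%E. Proof. exact: prim_rearr_lty (Ex n). Qed.
Local Notation G n := (rprim (a n)).

Definition rearr_liminf (t : R) : \bar R := limn_einf (a^~ t).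
Local Notation p := rearr_liminf.

Lemma submaj_decr n m : (n <= m)%N -> submaj alpha (x m) (x n).
Proof.
move=> /subnK <-; elim: (m - n)%N => [|k IH]; first by move=> t _; exact: lexx.
by apply: submaj_trans IH; rewrite addSn.
Qed.

Lemma prim_decr n m t : (n <= m)%N -> 0 < t -> (prim (a m) t <= prim (a n) t)%E.
Proof. by move=> nm t0; have /submajP H := submaj_decr nm; exact: H. Qed.

Lemma rearr_liminf_anti s t : s <= t -> (p t <= p s)%E.
Proof. by move=> st; apply: le_limn_einf => n; exact: a_anti. Qed.

Lemma rearr_liminf_ge0 t : (0 <= p t)%E.
Proof. by apply: (@limn_einf_ge _ _ _ 0%N) => m _; exact: a_ge0. Qed.

Lemma measurable_rearr_liminf D : measurable D -> measurable_fun D p.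
Proof.
move=> mD; apply: (measurable_funS measurableT) => //; apply: measurable_antitone.
exact: rearr_liminf_anti.
Qed.

(** The rearrangement of the antitone [p] is at most [p], and Fatou's lemma bounds the primitive of
    [p] by the lower limit of primitives that decrease with the index. *)
Lemma submaj_rearr_liminf n : submaj alpha p (x n).
Proof.
apply/submajP => t t0; apply: (@le_trans _ _ (prim p t)).
  rewrite prim.unlock; apply: ge0_le_integral => //.
  - by move=> s _; exact: rearr_ge0.
  - exact: measurable_rearr.
  - exact: measurable_rearr_liminf.
  - move=> s/=; rewrite in_itv/= => /andP[s0 _].
    apply: rearr_antitone_le => //; first exact: rearr_liminf_anti.
    exact: rearr_liminf_ge0.
apply: (@le_trans _ _ (limn_einf (fun m => prim (a m) t))).
  rewrite prim.unlock /rearr_liminf; apply: fatou => //.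
  by move=> m; exact: measurable_rearr.
apply: (@limn_einf_le_ub _ _ _ n) => m nm; exact: prim_decr.
Qed.

Lemma rearr_liminf_mem : mem p.
Proof.
apply: (K_monotone Esym Efatou alpha1 _ (Ex 0%N) (submaj_rearr_liminf 0%N)).1.
by apply: measurable_rearr_liminf; exact: measurable_dom.
Qed.

Lemma norm_rearr_liminf n : norm p <= norm (x n).
Proof.
apply: (K_monotone Esym Efatou alpha1 _ (Ex n) (submaj_rearr_liminf n)).2.
by apply: measurable_rearr_liminf; exact: measurable_dom.
Qed.

Let a_fin n t : 0 < t -> a n t \is a fin_num.
Proof. exact: rearr_fin (Ex n). Qed.

Lemma rprim_decr n m t : (n <= m)%N -> 0 < t -> G m t <= G n t.
Proof.
move=> nm t0; rewrite -lee_fin -(rprimE (@a_ge0 n) (@a_int n)).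
by rewrite -(rprimE (@a_ge0 m) (@a_int m)) prim_decr.
Qed.

Lemma rearr_le_div n t : 0 < t -> (a n t <= (G 0%N t / t)%:E)%E.
Proof.
move=> t0; rewrite -(fineK (a_fin n t0)) lee_fin ler_pdivlMr//.
apply: le_trans (rprim_ge_mul (@a_anti n) (@a_ge0 n) (a_int n) t0) _.
exact: rprim_decr.
Qed.

Lemma rearr_liminf_fin t : 0 < t -> p t \is a fin_num.
Proof.
move=> t0; rewrite ge0_fin_numE ?rearr_liminf_ge0//.
apply: (@le_lt_trans _ _ (G 0%N t / t)%:E); last by rewrite ltry.
by apply: (@limn_einf_le_ub _ _ _ 0%N) => m _; exact: rearr_le_div.
Qed.

Lemma rprim_cauchy t (e : R) : 0 < t -> 0 < e ->
  exists N, forall n m, (N <= n)%N -> (N <= m)%N -> `|G n t - G m t| < e.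
Proof.
move=> t0 e0.
have : cvgn (fun n => G n t).
  apply: nonincreasing_is_cvgn.
    by move=> n m nm; exact: rprim_decr.
  by exists 0 => _ [n _ <-]; apply: rprim_ge0; exact: a_ge0.
move=> /cvg_ex[l /= Gl]; have e2 : 0 < e / 2 by rewrite divr_gt0.
have /cvgrPdist_lt/(_ _ e2)[N _ HN] := Gl.
exists N => n m Nn Nm; have := HN n Nn; have := HN m Nm => /=.
rewrite !ltr_norml => /andP[h1 h2] /andP[h3 h4]; apply/andP; split; lra.
Qed.

(* Both sides are compared with the difference quotient of the primitives over
   [s, t], which converges because the primitives decrease. *)
Lemma rearr_liminf_shift s t (e : R) : 0 < s -> s < t -> 0 < e ->
  exists N, forall n, (N <= n)%N -> (a n t <= p s + e%:E)%E.
Proof.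
move=> s0 st e0; have t0 : 0 < t by exact: lt_trans st.
have ts0 : 0 < t - s by rewrite subr_gt0.
(* The Cauchy errors at [s] and [t] add up to [2 * r], which is [e] after division by [t - s]. *)
pose r := e * (t - s) / 2; have r0 : 0 < r by rewrite divr_gt0// mulr_gt0.
have [N1 H1] := rprim_cauchy s0 r0; have [N2 H2] := rprim_cauchy t0 r0.
exists (maxn N1 N2) => n; rewrite geq_max => /andP[N1n N2n].
rewrite -leeBlDr//; apply: (@limn_einf_ge _ _ _ (maxn N1 N2)) => m.
rewrite geq_max => /andP[N1m N2m].
rewrite leeBlDr// -(fineK (a_fin n t0)) -(fineK (a_fin m s0)) -EFinD lee_fin.
have K1 := rprim_incr_ge (@a_anti n) (@a_ge0 n) (a_int n) s0 (ltW st).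
have K2 := rprim_incr_le (@a_anti m) (@a_ge0 m) (a_int m) s0 (ltW st).
have := H1 n m N1n N1m; have := H2 n m N2n N2m.
rewrite !ltr_norml => /andP[h1 h2] /andP[h3 h4].
rewrite -(ler_pM2r ts0) mulrDl; rewrite /r in h1 h2 h3 h4; lra.
Qed.

Let bad : set R := [set t | 0 < t /\
  ~ forall e : R, 0 < e -> exists N, forall n, (N <= n)%N -> (a n t <= p t + e%:E)%E].

(** At a bad [t] some [e] has [a n t > p t + e] for arbitrarily large [n], whereas
    [rearr_liminf_shift] bounds [a n t] by nearly [p s] for [s < t]. Hence [p] jumps by at least [e]
    at [t]. *)
Let countable_bad : countable bad.
Proof.
apply: (@countable_jumps _ p) => [t [t0 _]|t [t0 nt]]; first exact: rearr_liminf_fin.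
apply: contrapT => H; apply: nt => e e0; apply: contrapT => H'.
apply: H; exists e => // s [s0 _] st; apply/lee_addgt0Pr => d d0.
have [N HN] := rearr_liminf_shift s0 st d0.
apply: contrapT => /negP; rewrite -ltNge => Hlt; apply: H'; exists N => n Nn.
by apply: le_trans (HN n Nn) _; exact: ltW.
Qed.

(** The positive part suffices: [a n <= p + w n] bounds the norms from above, and submajorization of
    [p] bounds them from below. *)
Definition rearr_excess n t : \bar R := maxe (a n t - p t)%E 0%E.
Local Notation w := rearr_excess.

Lemma rearr_excess_ge0 n t : (0 <= w n t)%E.
Proof. by rewrite le_max lexx orbT. Qed.

Lemma rearr_excess_le n t : (w n t <= a n t)%E.
Proof.
rewrite ge_max a_ge0 andbT.
by case: (a n t) (a_ge0 n t) (p t) (rearr_liminf_ge0 t) => [b| |]// b0 [c| |]// c0;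
  rewrite ?leey ?leNye// -EFinB lee_fin gerBl.
Qed.

Lemma measurable_rearr_excess n D : measurable D -> measurable_fun D (w n).
Proof.
move=> mD; apply: measurable_maxe; last exact: measurable_cst.
apply: emeasurable_funB; first exact: measurable_rearr.
exact: measurable_rearr_liminf.
Qed.

Let L0_w n : L0 alpha (w n).
Proof. by apply: measurable_rearr_excess; exact: measurable_dom. Qed.

Let w_le_abs n : ae_dom alpha (fun t => `|w n t| <= `|a n t|)%E.
Proof.
by apply: ae_domW => t _; rewrite !gee0_abs ?rearr_excess_ge0 ?rearr_excess_le.
Qed.

Lemma rearr_excess_mem n : mem (w n).
Proof. by apply: (bfs_solid (L0_w n) (bfs_rearr Esym (Ex n)).1 _).1. Qed.

Lemma submaj_rearr_excess n : submaj alpha (w n) (x 0%N).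
Proof.
apply: (@submaj_trans _ _ _ (x n)); last exact: submaj_decr.
apply/submajP => t t0; rewrite prim.unlock; apply: ge0_le_integral => //.
- by move=> s _; exact: rearr_ge0.
- exact: measurable_rearr.
- exact: measurable_rearr.
move=> s _; rewrite -(rearr_rearr (bfs_L0 (Ex n))).
by apply: le_rearr => //; exact: L0_rearr.
Qed.

Let exceed (e : R) n : set R := dom alpha `&` [set s | (e%:E < w n s)%E].

(** All [w n s] are at most [G 0 s / s], which tends to 0 as x_0* becomes small. *)
Lemma exceed_bounded (e : R) : 0 < e -> exists S, 0 < S /\ forall n, exceed e n `<=` `[0, S]%classic.
Proof.
move=> e0; have e2 : 0 < e / 2 by rewrite divr_gt0.
have [S0 S00 aS0] := rearr_van (Ex 0%N) e2.
(* Past [S], [G 0 S0] is at most [e * s / 2], and the growth of [G 0] after [S0] contributes at most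
   [e * s / 2]. *)
pose S := S0 + 2 * G 0%N S0 / e + 1.
have G0 : 0 <= 2 * G 0%N S0 / e.
  by rewrite divr_ge0 ?(ltW e0)// mulr_ge0// rprim_ge0.
exists S; split; first by rewrite /S; lra.
move=> n s [[s0 _] /= ews]; rewrite in_itv/= s0/= leNgt; apply/negP => Ss.
have s1 : 0 < s by rewrite /S in Ss; lra.
have : (e%:E < (G 0%N s / s)%:E)%E.
  by apply: lt_le_trans ews _; apply: le_trans (rearr_excess_le n s) _; exact: rearr_le_div.
rewrite lte_fin ltr_pdivlMr// ltNge => /negP; apply.
have S0s : S0 <= s by rewrite /S in Ss; lra.
have K := rprim_incr_le (@a_anti 0%N) (@a_ge0 0%N) (a_int 0%N) S00 S0s.
have aS : fine (a 0%N S0) <= e / 2 by rewrite -lee_fin fineK// a_fin.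
have K2 : fine (a 0%N S0) * (s - S0) <= e / 2 * s.
  apply: ler_pM => //; rewrite ?fine_ge0 ?subr_ge0//; lra.
have K3 : 2 * G 0%N S0 <= e * s.
  have : 2 * G 0%N S0 / e <= s by rewrite /S in Ss; lra.
  by rewrite ler_pdivrMr// (mulrC s).
by lra.
Qed.

(** The tail unions of the exceedance sets lie in one bounded interval and decrease to a subset of
    the countable set of bad points and 0. Continuity from above gives convergence in measure, which
    [gt_rearr] turns into smallness of the rearrangement at [t]. *)
Lemma rearr_excess_cvg0 (t e : R) : 0 < t -> 0 < e ->
  exists N, forall n, (N <= n)%N -> (rr (w n) t <= e%:E)%E.
Proof.
move=> t0 e0; have [S [S0 HS]] := exceed_bounded e0.
have mexc n : measurable (exceed e n).
  apply: emeasurable_fun_o_infty; first exact: measurable_dom.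
  exact: L0_w.
pose U m := \bigcup_(n in [set n | (m <= n)%N]) exceed e n.
have mU m : measurable (U m) by apply: bigcup_measurable.
have US m : U m `<=` `[0, S]%classic by move=> s [n _ /HS].
have Ufin : (mu (U 0%N) < +oo)%E.
  apply: (@le_lt_trans _ _ (mu `[0, S]%classic)).
    by apply: le_measure; [rewrite inE; exact: mU|rewrite inE; exact: measurable_itv|exact: US].
  by rewrite lebesgue_measure_itv_le ?subr0 ?ltry// ltW.
have mIU : measurable (\bigcap_m U m) by exact: bigcapT_measurable.
have IU : mu (\bigcap_m U m) = 0%E.
  apply: countable_lebesgue_measure0.
  apply: (@sub_countable _ _ _ (bad `|` [set 0])); last first.
    by rewrite -bigcup2E; apply: bigcup_countable => // -[|[|k]] _ //=.
  apply: subset_card_le => s Us.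
  have [n0 _ [[s0 _] _]] := Us 0%N I.
  have [->|sn0] := eqVneq s 0; first by right.
  have s1 : 0 < s by rewrite lt_neqAle eq_sym sn0.
  left; split => // H; have [N HN] := H e e0.
  have [n Nn [_ /= ews]] := Us N I.
  move: ews; apply/negP; rewrite -leNgt ge_max lee_fin (ltW e0) andbT.
  by rewrite leeBlDl ?rearr_liminf_fin// HN.
have cU : (mu (U m)) @[m --> \oo] --> 0%E.
  rewrite -IU; apply: nonincreasing_cvg_mu => //.
  by move=> m m' mm'; apply/subsetPset => s [n /= m'n ?]; exists n => //=; exact: leq_trans m'n.
have [N _ HN] : \forall m \near \oo, (mu (U m) < t%:E)%E.
  have : nbhs (0%E : \bar R) [set y | (y < t%:E)%E].
    by apply: open_nbhs_nbhs; split; [exact: open_ereal_lt_ereal|rewrite /= lte_fin].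
  by move=> /cU.
exists N => n Nn; rewrite leNgt gt_rearr ?(ltW e0)// -leNgt.
apply: le_trans (ltW (HN n Nn)); apply: le_measure; rewrite ?inE//.
- exact: measurable_distr_set.
- exact: mU.
move=> s [ds /=]; rewrite gee0_abs ?rearr_excess_ge0// => ews.
by exists n => /=.
Qed.

Hypothesis koc : K_order_continuous E.

Lemma norm_rearr_excess_cvg0 : norm (w n) @[n --> \oo] --> (0 : R).
Proof.
apply: (koc (Ex 0%N)) => [n|n|]; [exact: rearr_excess_mem|exact: submaj_rearr_excess|].
apply: ae_dom_gt0 => t dt t0; apply: cvge_ge0_small => [n|e e0].
  exact: rearr_ge0.
exact: rearr_excess_cvg0.
Qed.

Lemma norm_rearr_le n : norm (x n) <= norm p + norm (w n).
Proof.
rewrite -(bfs_rearr Esym (Ex n)).2.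
apply: (bfs_norm_le_add _ rearr_liminf_mem (rearr_excess_mem n) _).2.
  exact: L0_rearr.
apply: ae_dom_gt0 => t dt t0; rewrite !gee0_abs ?a_ge0 ?adde_ge0 ?rearr_liminf_ge0
  ?rearr_excess_ge0//.
rewrite addeC -leeBlDr ?rearr_liminf_fin// /rearr_excess.
by rewrite le_max lexx.
Qed.

(** The norm of [x n] lies between [norm p] and [norm p + norm (w n)]. *)
Lemma norm_rearr_liminf_lim l : norm (x n) @[n --> \oo] --> l -> norm p = l.
Proof.
move=> xl; apply/eqP; rewrite eq_le; apply/andP; split.
  rewrite -(cvg_lim _ xl)//; apply: limr_ge; first by apply/cvg_ex; exists l.
  by apply: nearW => n; exact: norm_rearr_liminf.
have : norm p + norm (w n) @[n --> \oo] --> norm p + 0.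
  by apply: cvgD; [exact: cvg_cst|exact: norm_rearr_excess_cvg0].
rewrite addr0 => pw; rewrite -(cvg_lim _ xl)// -(cvg_lim _ pw)//.
apply: ler_lim; [by apply/cvg_ex; exists l|by apply/cvg_ex; exists (norm p)|].
by apply: nearW => n; exact: norm_rearr_le.
Qed.

End decreasing_sequence.

Lemma rearr_dist_triangle x y z : mem x -> mem y -> mem z ->
  rearr_dist E x z <= rearr_dist E y x + rearr_dist E y z.
Proof.
move=> Ex Ey Ez.
have [Erx _] := bfs_rearr Esym Ex; have [Ery _] := bfs_rearr Esym Ey.
have [Erz _] := bfs_rearr Esym Ez.
rewrite /rearr_dist (bfs_norm_subC Ery Erx).
apply: (bfs_norm_le_add _ (bfs_mem_sub Erx Ery) (bfs_mem_sub Ery Erz) _).2.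
  exact: bfs_L0 (bfs_mem_sub Erx Erz).
apply: ae_dom_gt0 => t dt t0.
rewrite -(fineK (rearr_fin Esym alpha1 Ex t0)) -(fineK (rearr_fin Esym alpha1 Ey t0)).
rewrite -(fineK (rearr_fin Esym alpha1 Ez t0)) -!EFinB -EFinD lee_fin.
by rewrite addrA subrK.
Qed.

Lemma decreasing_uniformly_of_order_continuous :
  K_order_continuous E -> upper_locally_uniformly_K_monotone E ->
  decreasing_uniformly_K_monotone E.
Proof.
move=> koc ulukm x y l Ex Ey xy xl yl.
have xS n : submaj alpha (x n.+1) (x n) by case: (xy n).
pose p := rearr_liminf x.
have Ep : mem p := rearr_liminf_mem Ex xS.
have np : norm p = l := norm_rearr_liminf_lim Ex xS koc xl.
have px n : submaj alpha p (x n) := submaj_rearr_liminf xS n.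
have py n : submaj alpha p (y n) by apply: submaj_trans (px n) (xy n).2.
have dx := ulukm _ _ Ep Ex px; have dy := ulukm _ _ Ep Ey py.
rewrite np in dx dy.
apply: (@squeeze_cvgr _ _ _ _ (fun=> 0)
  (fun n => rearr_dist E p (x n) + rearr_dist E p (y n))); last first.
- by rewrite -[0]addr0; apply: cvgD; [exact: dx|exact: dy].
- exact: cvg_cst.
apply: nearW => n; apply/andP; split; last exact: rearr_dist_triangle.
apply: bfs_norm_ge0; apply: bfs_mem_sub.
  exact: (bfs_rearr Esym (Ex n)).1.
exact: (bfs_rearr Esym (Ey n)).1.
Qed.

End order_continuous_to_decreasing_uniform.

Theorem theorem3p4 (R : realType) (alpha : \bar R)
    (halpha : alpha = 1%E \/ alpha = +oo%E)
    (E : banachFunctionSpace alpha)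
    (Esym : symmetric_space E)
    (Efatou : fatou_property E)
    (Ephi : alpha = +oo%E -> fundamental_fun E t @[t --> +oo%R] --> +oo%R) :
  decreasing_uniformly_K_monotone E <->
  (K_order_continuous E /\ upper_locally_uniformly_K_monotone E).
Proof.
have alpha1 : (1 <= alpha)%E by case: halpha => ->; rewrite ?leey.
have rearr_van x (e : R) : bfs_mem E x -> 0 < e ->
    exists2 T, 0 < T & (rearr alpha x T <= e%:E)%E.
  exact: rearr_vanishes.
split=> [dukm|[koc ulukm]]; last exact: decreasing_uniformly_of_order_continuous.
split; first exact: decreasing_uniform_K_order_continuous.
(* The constant sequence [x] is decreasing for submajorization and lies below every [u n]. *)
move=> x u Ex Eu xu nu; apply: (dukm (fun=> x) u (bfs_norm E x)) => //.
  by move=> n; split => // t _; exact: lexx.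
exact: cvg_cst.
Qed.
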